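(* Suppose that $f\in R=D[t;\sigma]$ is monic, irreducible, of degree $m>1$, and not right-invariant, and let $1\le l<k$ be an integer. Suppose that the set $P=\{d_0+d_1t+\dots+d_{lm-1}t^{lm-1}+\nu\rho(d_0)t^{lm}\mid d_i\in D\}$ does not contain any polynomial of degree $lm$ whose irreducible factors are all similar to $f$. Then $S_{n,m,l}(\nu,\rho,f)$ defines an $F'$-linear MRD code $\mathcal{C}_{n,m,l}$ in $M_k(B)$ with minimum distance $k-l+1$. In particular, if $\deg(h)=dmn$, then this code is an $F'$-linear MRD code in $M_{dn}(E_{\hat h})$ with minimum distance $dn-l+1$.
   Context: Setting. $D$ is a division algebra, finite-dimensional over its center $C$, of degree $d$ (so $\dim_C D=d^2$). $\sigma$ is a ring automorphism of $D$ of finite order $n$ modulo inner automorphisms: $n$ is the least positive integer such that $\sigma^n$ is inner, and $\sigma^n(z)=uzu^{-1}$ for all $z\in D$, where $u\in D^\times$ is chosen with $\sigma(u)=u$. Put $F=C\cap\mathrm{Fix}(\sigma)$. $R=D[t;\sigma]$ is the skew polynomial ring of polynomials $\sum a_it^i$ ($a_i\in D$) with $ta=\sigma(a)t$; its center is $C(R)=F[u^{-1}t^n]\cong F[x]$, $x=u^{-1}t^n$. $f$ is right-invariant if $Rf$ is a two-sided ideal. Two nonzero polynomials $f_1,f_2\in R$ are similar if $R/Rf_1\cong R/Rf_2$ as left $R$-modules. The minimal central left multiple of $f$ is the unique $h\in C(R)$ of minimal degree with $h=gf$ for some $g\in R$ and $h(t)=\hat h(u^{-1}t^n)$ with $\hat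 h\in F[x]$ monic. $E_{\hat h}=F[x]/(\hat h(x))$, which is a field for irreducible $f$. $k$ is the number of irreducible factors in a factorization of $h$ into irreducibles in $R$. The Petit algebra $S_f$ is $R_m=\{g\in R\mid \deg g<m\}$ with multiplication $a\cdot b=$ remainder of $ab$ after right division by $f$ ($ab=qf+r$). $B=\mathrm{Nuc}_r(S_f)$ is its right nucleus, $B=\{z\in R_m\mid fz\in Rf\}$. It is known that $B$ is a division algebra with center $E_{\hat h}$, of degree $s=dn/k$ over $E_{\hat h}$, that $\deg h=km$, and that $R/Rh\cong M_k(B)$; if $\deg h=dmn$ then $k=dn$ and $B\cong E_{\hat h}$. $R/Rf$ is a free right $B$-module of rank $k$ via $(a+Rf)z=az+Rf$. $\nu\in D$, $\rho\in\mathrm{Aut}(D)$, $F'=\mathrm{Fix}(\rho)\cap F$, and $F/F'$ is assumed finite-dimensional. $S_{n,m,l}(\nu,\rho,f)=\{a+Rh\mid a\in P\}\subset R/Rh$. For $a\in P$, $L_a\in\mathrm{End}_B(R/Rf)$ is $L_a(b+Rf)=ab+Rf$, $M_a\in M_k(B)$ is the matrix of $L_a$ with respect to a fixed right $B$-basis of $R/Rf$, and $\mathcal{C}_{n,m,l}=\{M_a\mid a\in P\}\subset M_k(B)$ is the code defined by $S_{n,m,l}(\nu,\rho,f)$. The distance on $M_k(B)$ is $d(X,Y)=\mathrm{colrank}(X-Y)$, where colrank is the dimension of the right $B$-module generated by the columns; the minimum distance $d_{\mathcal C}$ of a code $\mathcal C$ is the minimum of $d(X,Y)$ over distinct $X,Y\in\mathcal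 C$. An $F'$-linear code $\mathcal C\subset M_k(B)$ is an MRD (maximum rank distance) code if it attains the Singleton-like bound $\dim_{F'}\mathcal C\le k(k-d_{\mathcal C}+1)[B:F']$. *)

(* Defs.v *)
From HB Require Import structures.
From mathcomp Require Import all_boot all_order all_algebra all_field.
From mathcomp Require Import zify.
From mathcomp Require Import boolp classical_sets.

Set Implicit Arguments.
Unset Strict Implicit.
Unset Printing Implicit Defensive.

Import GRing.Theory.
Local Open Scope ring_scope.
Local Open Scope quotient_scope.

(* The subfield {c in L | tau (i c) = i c} of a field L embedded in A by i. *)
Section FixField.
Variables (L : fieldType) (A : unitRingType).
Variables (i : {rmorphism L -> A}) (tau : {rmorphism A -> A}).

Definition fix_pred : {pred L} := [pred c | tau (i c) == i c].

Fact fix_divring_closed : divring_closed fix_pred.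
Proof.
split=> [|x y|x y]; rewrite !inE; first by rewrite !rmorph1.
  by move=> /eqP ex /eqP ey; rewrite !rmorphB /= ex ey.
move=> /eqP ex /eqP ey; rewrite !rmorphM /= ex.
have [->|y0] := eqVneq y 0; first by rewrite invr0 !rmorph0.
by rewrite fmorphV rmorphV ?ey // fmorph_unit.
Qed.

HB.instance Definition _ := GRing.isDivringClosed.Build L fix_pred
  fix_divring_closed.

Record fixfield : predArgType :=
  FixField { fix_val : L; fix_valP : fix_val \in fix_pred }.

HB.instance Definition _ := [isSub for fix_val].
HB.instance Definition _ := [Choice of fixfield by <:].
HB.instance Definition _ := [SubChoice_isSubComUnitRing of fixfield by <:].
HB.instance Definition _ :=
  [SubComUnitRing_isSubIntegralDomain of fixfield by <:].
HB.instance Definition _ := [SubIntegralDomain_isSubField of fixfield by <:].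

End FixField.

Section NCRing.
Variable R : nzRingType.
Implicit Types f g h x : R.

Definition nc_central x := forall y, x * y = y * x.

Definition nc_unit x := exists y, x * y = 1 /\ y * x = 1.

Definition nc_irreducible f :=
  [/\ f <> 0, ~ nc_unit f & forall g h, f = g * h -> nc_unit g \/ nc_unit h].

Definition lideal f : {pred R} := [pred g | `[< exists q, g = q * f >]].

Lemma lidealP f g : reflect (exists q, g = q * f) (g \in lideal f).
Proof. exact: asboolP. Qed.

Definition right_invariant f := forall g r, g \in lideal f -> g * r \in lideal f.

Fact lideal_zmod_closed f : zmod_closed (lideal f).
Proof.
split=> [|x y /lidealP[p ->] /lidealP[q ->]]; apply/lidealP.
  by exists 0; rewrite mul0r.
by exists (p - q); rewrite mulrBl.
Qed.

HB.instance Definition _ f := GRing.isZmodClosed.Build R (lideal f)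
  (lideal_zmod_closed f).

Lemma lideal_mull f r g : g \in lideal f -> r * g \in lideal f.
Proof. by case/lidealP=> q ->; apply/lidealP; exists (r * q); rewrite mulrA. Qed.

Definition lquot f : Type := {ideal_quot (lideal f)}.

End NCRing.

Section LQuot.
Variables (R : nzRingType) (f : R).

HB.instance Definition _ := Choice.on (lquot f).
HB.instance Definition _ := EqQuotient.on (lquot f).
HB.instance Definition _ := GRing.Zmodule.on (lquot f).
HB.instance Definition _ := ZmodQuotient.on (lquot f).

Lemma lquot_eqE (x y : R) :
  (\pi_(lquot f) x == \pi_(lquot f) y) = (x - y \in lideal f).
Proof. by rewrite -Quotient.idealrBE. Qed.

Definition lquot_scale (a : R) (v : lquot f) : lquot f :=
  \pi_(lquot f) (a * repr v).

Lemma lquot_scaleE a b : lquot_scale a (\pi b) = \pi_(lquot f) (a * b).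
Proof.
apply/eqP; rewrite lquot_eqE -mulrBr lideal_mull // -lquot_eqE.
by rewrite reprK.
Qed.

Fact lquot_scaleA a b v : lquot_scale a (lquot_scale b v) = lquot_scale (a * b) v.
Proof. by rewrite -[v]reprK !lquot_scaleE mulrA. Qed.

Fact lquot_scale1 : left_id 1 lquot_scale.
Proof. by move=> v; rewrite -[v]reprK lquot_scaleE mul1r. Qed.

Fact lquot_scaleDr : right_distributive lquot_scale +%R.
Proof.
move=> a v w; rewrite -[v]reprK -[w]reprK.
by rewrite -[_ + _]raddfD !lquot_scaleE mulrDr raddfD.
Qed.

Fact lquot_scaleDl v : {morph lquot_scale^~ v : a b / a + b}.
Proof. by move=> a b; rewrite -[v]reprK !lquot_scaleE mulrDl raddfD. Qed.

HB.instance Definition _ := GRing.Zmodule_isLmodule.Build R (lquot f)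
  lquot_scaleA lquot_scale1 lquot_scaleDr lquot_scaleDl.

End LQuot.

Section Factors.
Variable R : nzRingType.
Implicit Types f g p : R.

Definition nc_similar f g :=
  exists phi : {linear lquot f -> lquot g}, bijective phi.

Definition irr_factor p g := nc_irreducible p /\ exists a b, g = a * p * b.

Definition has_irr_factorization g k := exists2 s : seq R,
  size s = k & (forall p, p \in s -> nc_irreducible p) /\ g = \prod_(p <- s) p.

End Factors.

(* D[t; sigma], with t * a = sigma a * t.  The coefficients, written on the
   left of the powers of t, are stored in a {poly D}, of which only the
   additive structure is used. *)
Record skewpoly (D : nzRingType) (sigma : {rmorphism D -> D}) : predArgType :=
  SkewPoly { skew_coefs :> {poly D} }.

Section SkewPoly.
Variables (D : nzRingType) (sigma : {rmorphism D -> D}).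
Local Notation skewpoly := (skewpoly sigma).
Local Notation skew_coefs := (@skew_coefs D sigma).
Local Notation SkewPoly := (@SkewPoly D sigma).

HB.instance Definition _ := [isNew for skew_coefs].
HB.instance Definition _ := [Choice of skewpoly by <:].

Implicit Types p q r : skewpoly.

Lemma skewP p q : (forall i, p`_i = q`_i) -> p = q.
Proof. by move=> e; apply/val_inj/polyP. Qed.

Definition skew_zero := SkewPoly 0.
Definition skew_opp p := SkewPoly (- (p : {poly D})).
Definition skew_add p q := SkewPoly ((p : {poly D}) + q).

Fact skew_addA : associative skew_add.
Proof. by move=> p q r; apply: val_inj; rewrite /= addrA. Qed.
Fact skew_addC : commutative skew_add.
Proof. by move=> p q; apply: val_inj; rewrite /= addrC. Qed.
Fact skew_add0 : left_id skew_zero skew_add.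
Proof. by move=> p; apply: val_inj; rewrite /= add0r. Qed.
Fact skew_addN : left_inverse skew_zero skew_opp skew_add.
Proof. by move=> p; apply: val_inj; rewrite /= addNr. Qed.

HB.instance Definition _ := GRing.isZmodule.Build skewpoly
  skew_addA skew_addC skew_add0 skew_addN.

Fact skew_coefs_zmod_morphism : zmod_morphism skew_coefs.
Proof. by []. Qed.
HB.instance Definition _ := GRing.isZmodMorphism.Build skewpoly {poly D}
  skew_coefs skew_coefs_zmod_morphism.

Lemma skew_coefD p q i : (p + q)`_i = p`_i + q`_i.
Proof. exact: coefD. Qed.

Lemma skew_coefB p q i : (p - q)`_i = p`_i - q`_i.
Proof. exact: coefB. Qed.

Definition skewC (c : D) : skewpoly := SkewPoly c%:P.

Definition skewX : skewpoly := SkewPoly 'X.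

Definition skew_mul p q : skewpoly := SkewPoly
  (\poly_(i < (size p + size q).-1)
     \sum_(j < i.+1) p`_j * iter j sigma q`_(i - j)).

Lemma itersD j : {morph iter j sigma : x y / x + y}.
Proof. by elim: j => // j IH x y; rewrite !iterS IH rmorphD. Qed.
Lemma itersM j : {morph iter j sigma : x y / x * y}.
Proof. by elim: j => // j IH x y; rewrite !iterS IH rmorphM. Qed.
Lemma iters0 j : iter j sigma 0 = 0.
Proof. by elim: j => // j IH; rewrite iterS IH rmorph0. Qed.
Lemma iters1 j : iter j sigma 1 = 1.
Proof. by elim: j => // j IH; rewrite iterS IH rmorph1. Qed.
Lemma iters_sum j I (s : seq I) (P : pred I) (E : I -> D) :
  iter j sigma (\sum_(i <- s | P i) E i) = \sum_(i <- s | P i) iter j sigma (E i).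
Proof. exact: (big_morph _ (itersD j) (iters0 j)). Qed.

Fact skew_coef_mul p q i :
  (skew_mul p q)`_i = \sum_(j < i.+1) p`_j * iter j sigma q`_(i - j).
Proof.
rewrite /skew_mul /= coef_poly; case: ltnP => // le_pq_i.
rewrite big1 // => j _; have [lp|gp] := leqP (size p) j.
  by rewrite nth_default // mul0r.
rewrite [q`_ _]nth_default ?iters0 ?mulr0 //.
have := ltn_ord j; move: le_pq_i gp; move: (size p) (size q) (j : nat) => a b c.
by move=> h1 h2 h3; lia.
Qed.

Fact skew_coef_mul_rev p q i :
  (skew_mul p q)`_i = \sum_(j < i.+1) p`_(i - j) * iter (i - j) sigma q`_j.
Proof.
rewrite skew_coef_mul (reindex_inj rev_ord_inj) /=; apply: eq_bigr => j _.
by rewrite subSS subKn // -ltnS.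
Qed.

Fact skew_mulA : associative skew_mul.
Proof.
move=> p q r; apply: skewP => i; rewrite skew_coef_mul skew_coef_mul_rev.
pose coef3 j k := p`_j * iter j sigma (q`_(i - j - k) * iter (i - j - k) sigma r`_k).
transitivity (\sum_(j < i.+1) \sum_(k < i.+1 | (k <= i - j)%N) coef3 j k).
  apply: eq_bigr => /= j _; rewrite skew_coef_mul_rev iters_sum big_distrr /=.
  by rewrite (big_ord_narrow_leq (leq_subr _ _)).
rewrite (exchange_big_dep predT) //=; apply: eq_bigr => k _.
transitivity (\sum_(j < i.+1 | (j <= i - k)%N) coef3 j k).
  apply: eq_bigl => j; rewrite -ltnS -(ltnS j) -!subSn ?leq_ord //.
  by rewrite -subn_gt0 -(subn_gt0 j) -!subnDA addnC.
rewrite (big_ord_narrow_leq (leq_subr _ _)) skew_coef_mul big_distrl /=.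
apply: eq_bigr => j _; rewrite /coef3 itersM mulrA -iterD subnAC subnKC //.
by rewrite -ltnS.
Qed.

Fact skew_mul1l : left_id (skewC 1) skew_mul.
Proof.
move=> p; apply: skewP => i; rewrite skew_coef_mul big_ord_recl subn0.
by rewrite big1 => [|j _]; rewrite /= coefC ?addr0 ?mul1r ?mul0r.
Qed.

Fact skew_mul1r : right_id (skewC 1) skew_mul.
Proof.
move=> p; apply: skewP => i; rewrite skew_coef_mul_rev big_ord_recl subn0.
rewrite big1 => [|j _]; rewrite /= coefC ?addr0 ?iters0 ?mulr0 //.
by rewrite iters1 mulr1.
Qed.

Fact skew_mulDl : left_distributive skew_mul +%R.
Proof.
move=> p q r; apply: skewP => i; rewrite skew_coefD !skew_coef_mul.
rewrite -big_split; apply: eq_bigr => j _ /=.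
by rewrite skew_coefD mulrDl.
Qed.

Fact skew_mulDr : right_distributive skew_mul +%R.
Proof.
move=> p q r; apply: skewP => i; rewrite skew_coefD !skew_coef_mul.
rewrite -big_split; apply: eq_bigr => j _ /=.
by rewrite skew_coefD itersD mulrDr.
Qed.

Fact skew_one_neq0 : skewC 1 != 0.
Proof.
by apply/eqP => /(congr1 val) /= /eqP; rewrite polyC_eq0 oner_eq0.
Qed.

HB.instance Definition _ := GRing.Zmodule_isNzRing.Build skewpoly
  skew_mulA skew_mul1l skew_mul1r skew_mulDl skew_mulDr skew_one_neq0.

Lemma skew_coefM p q i :
  (p * q)`_i = \sum_(j < i.+1) p`_j * iter j sigma q`_(i - j).
Proof. exact: skew_coef_mul. Qed.

Lemma skew_coefMr p q i :
  (p * q)`_i = \sum_(j < i.+1) p`_(i - j) * iter (i - j) sigma q`_j.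
Proof. exact: skew_coef_mul_rev. Qed.

Lemma skew_coefCM c p i : (skewC c * p)`_i = c * p`_i.
Proof.
rewrite skew_coefM big_ord_recl subn0 big1 => [|j _] /=.
  by rewrite coefC addr0.
by rewrite coefC mul0r.
Qed.

Lemma skew_coefMC p c i : (p * skewC c)`_i = p`_i * iter i sigma c.
Proof.
rewrite skew_coefMr big_ord_recl subn0 big1 => [|j _] /=.
  by rewrite coefC addr0.
by rewrite coefC iters0 mulr0.
Qed.

Lemma skew_coefXM p i : (skewX * p)`_i = if i is j.+1 then sigma p`_j else 0.
Proof.
rewrite skew_coefM; case: i => [|i].
  by rewrite big_ord_recl big_ord0 /= coefX mul0r addr0.
rewrite big_ord_recl big_ord_recl big1 => [|j _] /=.
  by rewrite !coefX mul0r mul1r add0r addr0 /= subSS subn0.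
by rewrite coefX mul0r.
Qed.

Lemma skew_coefMX p i : (p * skewX)`_i = if i is j.+1 then p`_j else 0.
Proof.
rewrite skew_coefMr; case: i => [|i].
  by rewrite big_ord_recl big_ord0 /= coefX mulr0 addr0.
rewrite big_ord_recl big_ord_recl big1 => [|j _] /=.
  rewrite !coefX /= iters0 rmorph0 mulr0 add0r addr0 subSS subn0.
  by rewrite iters1 mulr1.
by rewrite coefX iters0 mulr0.
Qed.

Lemma skewX_comm a : skewX * skewC a = skewC (sigma a) * skewX.
Proof.
apply: skewP => i; rewrite skew_coefXM skew_coefMX.
by case: i => // i; rewrite /= !coefC; case: eqP => // _; rewrite rmorph0.
Qed.

Fact skewC_zmod_morphism : zmod_morphism skewC.
Proof. by move=> a b; apply: val_inj; rewrite /= polyCB. Qed.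
Fact skewC_monoid_morphism : monoid_morphism skewC.
Proof.
split=> // a b; apply: skewP => i; rewrite skew_coefCM /= !coefC.
by case: eqP => // _; rewrite mulr0.
Qed.
HB.instance Definition _ := GRing.isZmodMorphism.Build D skewpoly skewC
  skewC_zmod_morphism.
HB.instance Definition _ := GRing.isMonoidMorphism.Build D skewpoly skewC
  skewC_monoid_morphism.

Definition skew_deg p : nat := (size p).-1.

Definition skew_monic p := lead_coef p == 1.

(* One step of the right division of p by f (meant for f monic), then the
   remainder. *)
Definition skew_red (f p : skewpoly) : skewpoly :=
  if (size p < size f)%N then p
  else p - skewC (lead_coef p) * skewX ^+ (size p - size f) * f.

Definition skew_rem (f p : skewpoly) : skewpoly := iter (size p) (skew_red f) p.

End SkewPoly.

Record monic_skewpoly (D : nzRingType) (sigma : {rmorphism D -> D}) :=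
  MonicSkewPoly {
    monic_skewpoly_val :> skewpoly sigma;
    monic_skewpolyP :
      skew_monic monic_skewpoly_val && (0 < skew_deg monic_skewpoly_val)%N
  }.

(* S_f = (R_m, petit_mul) for f monic of degree m > 0, and its right nucleus. *)
Section Petit.
Variables (D : nzRingType) (sigma : {rmorphism D -> D}).
Local Notation R := (skewpoly sigma).
Variable f : monic_skewpoly sigma.
Implicit Types p q r : R.

Lemma monic_skew_lead : f`_(size f).-1 = 1.
Proof. by case: f => g /= /andP[/eqP]. Qed.

Lemma monic_skew_size : (1 < size f)%N.
Proof. by case: f => g /= /andP[_]; rewrite /skew_deg; case: (size _) => [|[]]. Qed.

Lemma skew_coefXnM j p i :
  (skewX sigma ^+ j * p)`_i = if (i < j)%N then 0 else iter j sigma p`_(i - j).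
Proof.
elim: j i => [|j IH] i; first by rewrite expr0 mul1r subn0.
rewrite exprS -mulrA skew_coefXM; case: i => [|i] //.
by rewrite IH ltnS subSS; case: ifP => // _; rewrite rmorph0.
Qed.

Lemma skew_red_size p :
  (size f <= size p)%N -> (size (skew_red f p) < size p)%N.
Proof.
have f1 := monic_skew_size.
move=> le_fp; rewrite /skew_red ifN -?leqNgt //.
suff: (size (p - skewC sigma (lead_coef p) * skewX sigma ^+ (size p - size f)%N * f : R)%R
        <= (size p).-1)%N by lia.
apply/leq_sizeP => i le_pi; rewrite skew_coefB -mulrA skew_coefCM skew_coefXnM.
have -> : (i < size p - size f)%N = false by lia.
have [->|ne] := eqVneq i (size p).-1.
  have -> : ((size p).-1 - (size p - size f) = (size f).-1)%N by lia.
  by rewrite monic_skew_lead iters1 mulr1 subrr.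
have le_pi' : (size p <= i)%N by lia.
rewrite [p`_i]nth_default // [f`_ _]nth_default ?iters0 ?mulr0 ?subr0 //.
by move: f1 le_fp le_pi'; move: (size f) (size p) => a b; clear; lia.
Qed.

Lemma skew_red_eq p : exists q, p = q * f + skew_red f p.
Proof.
rewrite /skew_red; case: ifP => _; first by exists 0; rewrite mul0r add0r.
by exists (skewC sigma (lead_coef p) * skewX sigma ^+ (size p - size f)); rewrite addrC subrK.
Qed.

Lemma skew_rem_size p : (size (skew_rem f p) < size f)%N.
Proof.
have f1 := monic_skew_size.
suff H k : (size (iter k (skew_red f) p) < size f)%N
    \/ (size (iter k (skew_red f) p) <= size p - k)%N.
  by have [//|] := H (size p); rewrite /skew_rem; lia.
elim: k => [|k IH]; first by right; rewrite subn0.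
rewrite iterS; set r := iter k _ p in IH *.
have [lt_rf|le_fr] := ltnP (size r) (size f).
  by left; rewrite /skew_red lt_rf.
by have := skew_red_size le_fr; right; lia.
Qed.

Lemma skew_rem_eq p : exists q, p = q * f + skew_rem f p.
Proof.
rewrite /skew_rem; elim: (size p) => [|k [q Eq]] /=.
  by exists 0; rewrite mul0r add0r.
have [q' Eq'] := skew_red_eq (iter k (skew_red f) p).
by exists (q + q'); rewrite mulrDl -addrA -Eq'.
Qed.

Lemma skew_mul_monic_size q : q != 0 -> (size f <= size (q * f)%R)%N.
Proof.
have f1 := monic_skew_size; move=> q0.
have sq : (0 < size q)%N.
  by rewrite size_poly_gt0; apply: contraNneq q0 => e; apply/eqP/val_inj.
rewrite leqNgt; apply/negP => lt.
have: (q * f)`_((size q).-1 + (size f).-1) = 0.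
  apply: nth_default; move: f1 sq lt.
  by move: (size f) (size q) (size (q * f)%R) => a b c; clear; lia.
have lt_q : ((size q).-1 < ((size q).-1 + (size f).-1).+1)%N by lia.
rewrite skew_coefM (bigD1 (Ordinal lt_q)) //= addKn monic_skew_lead iters1 mulr1.
rewrite big1 ?addr0.
  by apply/eqP; rewrite -[_`__]/(lead_coef _) lead_coef_eq0 -size_poly_gt0.
move=> j /negP ne_j; have [le_qj|lt_jq] := leqP (size q) j.
  by rewrite nth_default ?mul0r.
rewrite [f`_ _]nth_default ?iters0 ?mulr0 //.
have nj : (j : nat) <> (size q).-1 by move=> e; apply: ne_j; apply/eqP/val_inj.
move: f1 sq lt_jq nj.
by move: (size f) (size q) (j : nat) => a b c; clear; lia.
Qed.

Lemma skew_size_add p q n :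
  (size p < n)%N -> (size q < n)%N -> (size (p + q : R)%R < n)%N.
Proof.
move=> lp lq; apply: leq_ltn_trans (size_polyD p q) _.
by rewrite gtn_max lp.
Qed.

Lemma skew_size_opp p : size (- p : R) = size p.
Proof. exact: size_polyN. Qed.

Lemma skew_rem_unique q r p :
  (size r < size f)%N -> p = q * f + r -> skew_rem f p = r.
Proof.
move=> lr Ep; have [q' Eq'] := skew_rem_eq p.
have E : (q - q') * f = skew_rem f p - r.
  apply/eqP; rewrite mulrBl subr_eq addrAC -subr_eq opprK.
  by rewrite -Ep [in X in X == _]Eq' addrC.
have [/eqP e|ne] := eqVneq (q - q') 0.
  by move/eqP: E; rewrite (eqP e) mul0r eq_sym subr_eq0 => /eqP.
have := skew_mul_monic_size ne; rewrite leqNgt E.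
by rewrite skew_size_add ?skew_size_opp ?skew_rem_size.
Qed.

Lemma skew_rem_id p : (size p < size f)%N -> skew_rem f p = p.
Proof. by move=> lp; apply: (@skew_rem_unique 0); rewrite ?mul0r ?add0r. Qed.

Lemma skew_remD p q : skew_rem f (p + q) = skew_rem f p + skew_rem f q.
Proof.
have [a Ea] := skew_rem_eq p; have [b Eb] := skew_rem_eq q.
apply: (@skew_rem_unique (a + b)); first by apply: skew_size_add; apply: skew_rem_size.
by rewrite mulrDl addrACA -Ea -Eb.
Qed.

Lemma skew_remN p : skew_rem f (- p) = - skew_rem f p.
Proof.
have [a Ea] := skew_rem_eq p; apply: (@skew_rem_unique (- a)).
  by rewrite skew_size_opp skew_rem_size.
by rewrite mulNr -opprD -Ea.
Qed.

Lemma skew_rem_mull q p : skew_rem f (q * f + p) = skew_rem f p.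
Proof.
have [a Ea] := skew_rem_eq p; apply: (@skew_rem_unique (q + a)).
  exact: skew_rem_size.
by rewrite mulrDl -addrA -Ea.
Qed.

Lemma skew_rem_mulr p q : skew_rem f (p * skew_rem f q) = skew_rem f (p * q).
Proof.
have [a Ea] := skew_rem_eq q.
by rewrite [in RHS]Ea mulrDr mulrA skew_rem_mull.
Qed.

Lemma skew_rem_eq0 p : (skew_rem f p == 0) = (p \in lideal (f : R)).
Proof.
apply/eqP/lidealP => [e|[q ->]].
  by have [q Eq] := skew_rem_eq p; exists q; rewrite [LHS]Eq e addr0.
apply: (@skew_rem_unique q); last by rewrite addr0.
by rewrite size_poly0 (ltn_trans _ monic_skew_size).
Qed.

Definition petit_mul p q : R := skew_rem f (p * q).

Definition right_nucleus : {pred R} := [pred z : R | (size z < size f)%N &&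
  `[< forall a b : R, (size a < size f)%N -> (size b < size f)%N ->
        petit_mul (petit_mul a b) z = petit_mul a (petit_mul b z) >]].

Lemma right_nucleusP (z : R) : reflect
  ((size z < size f)%N /\
   forall a b : R, (size a < size f)%N -> (size b < size f)%N ->
     petit_mul (petit_mul a b) z = petit_mul a (petit_mul b z))
  (z \in right_nucleus).
Proof. by rewrite inE; apply: (iffP andP) => -[? /asboolP]. Qed.

Lemma petit_mulDl p q r : petit_mul (p + q) r = petit_mul p r + petit_mul q r.
Proof. by rewrite /petit_mul mulrDl skew_remD. Qed.

Lemma petit_mulDr p q r : petit_mul p (q + r) = petit_mul p q + petit_mul p r.
Proof. by rewrite /petit_mul mulrDr skew_remD. Qed.

Lemma petit_mulrN p q : petit_mul p (- q) = - petit_mul p q.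
Proof. by rewrite /petit_mul mulrN skew_remN. Qed.

Lemma petit_mul_size p q : (size (petit_mul p q) < size f)%N.
Proof. exact: skew_rem_size. Qed.

Fact right_nucleus_zmod_closed : zmod_closed right_nucleus.
Proof.
split=> [|x y /right_nucleusP[lx hx] /right_nucleusP[ly hy]].
  apply/right_nucleusP; split=> [|a b _ _].
    by rewrite size_poly0 (ltn_trans _ monic_skew_size).
  by rewrite /petit_mul !mulr0 skew_rem_mulr mulr0.
apply/right_nucleusP; split=> [|a b la lb].
  by apply: skew_size_add; rewrite ?skew_size_opp.
by rewrite !petit_mulDr !petit_mulrN hx ?hy.
Qed.

HB.instance Definition _ := GRing.isZmodClosed.Build R right_nucleus
  right_nucleus_zmod_closed.

Record nucr : predArgType := NucR { nucr_val : R; _ : nucr_val \in right_nucleus }.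

HB.instance Definition _ := [isSub for nucr_val].
HB.instance Definition _ := [Choice of nucr by <:].
HB.instance Definition _ := [SubChoice_isSubZmodule of nucr by <:].

Fact nucr_one_proof : 1 \in right_nucleus.
Proof.
have s1 : (size (1%R : R) < size f)%N by rewrite size_poly1 monic_skew_size.
apply/right_nucleusP; split=> // a b la lb.
by rewrite /petit_mul !mulr1 [skew_rem f b]skew_rem_id // skew_rem_id ?skew_rem_size.
Qed.

Fact nucr_mul_proof (x y : nucr) : petit_mul (val x) (val y) \in right_nucleus.
Proof.
have /right_nucleusP[lx hx] := valP x; have /right_nucleusP[ly hy] := valP y.
apply/right_nucleusP; split=> [|a b la lb]; first exact: petit_mul_size.
by rewrite -hy ?petit_mul_size // hx // hy ?petit_mul_size // hy.
Qed.

Definition nucr_one := NucR nucr_one_proof.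
Definition nucr_mul (x y : nucr) := NucR (nucr_mul_proof x y).

Fact nucr_mulA : associative nucr_mul.
Proof.
move=> x y z; apply: val_inj => /=.
have /right_nucleusP[lx _] := valP x; have /right_nucleusP[ly _] := valP y.
by have /right_nucleusP[_ ->] := valP z.
Qed.

Fact nucr_mul1r : left_id nucr_one nucr_mul.
Proof.
move=> x; apply: val_inj; rewrite /= /petit_mul mul1r.
by have /right_nucleusP[lx _] := valP x; rewrite skew_rem_id.
Qed.

Fact nucr_mulr1 : right_id nucr_one nucr_mul.
Proof.
move=> x; apply: val_inj; rewrite /= /petit_mul mulr1.
by have /right_nucleusP[lx _] := valP x; rewrite skew_rem_id.
Qed.

Fact nucr_mulDl : left_distributive nucr_mul +%R.
Proof. by move=> x y z; apply: val_inj; exact: petit_mulDl. Qed.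

Fact nucr_mulDr : right_distributive nucr_mul +%R.
Proof. by move=> x y z; apply: val_inj; exact: petit_mulDr. Qed.

Fact nucr_one_neq0 : nucr_one != 0.
Proof. by apply/eqP => /(congr1 val)/eqP; rewrite /= oner_eq0. Qed.

HB.instance Definition _ := GRing.Zmodule_isNzRing.Build nucr
  nucr_mulA nucr_mul1r nucr_mulr1 nucr_mulDl nucr_mulDr nucr_one_neq0.

(* This fails for f of degree 1, where S_f = D is associative. *)
Lemma right_nucleusE (z : R) : (1 < skew_deg f)%N ->
  (z \in right_nucleus) = (size z < size f)%N && ((f : R) * z \in lideal (f : R)).
Proof.
move=> m1; have f2 : (2 < size f)%N by move: m1; rewrite /skew_deg; case: (size _) => [|[]].
have sX k : (size (skewX sigma ^+ k) <= k.+1)%N.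
  apply/leq_sizeP => j; rewrite -[_ ^+ k]mulr1 skew_coefXnM leqNgt ltnS => lt.
  case: ifP => // h; rewrite coef1; case: eqP => [e|_]; last by rewrite iters0.
  by move: h lt e; lia.
apply/right_nucleusP/andP => -[lz hz]; split=> //; last first.
  move=> a b la lb; rewrite /petit_mul skew_rem_mulr mulrA.
  have [q Eq] := skew_rem_eq (a * b); rewrite [in RHS]Eq mulrDl -mulrA.
  by case/lidealP: hz => g ->; rewrite mulrA skew_rem_mull.
have sXm : (size (skewX sigma ^+ (size f).-2) < size f)%N.
  by apply: leq_ltn_trans (sX _) _; move: f2; case: (size f) => [|[|[]]].
have sX1 : (size (skewX sigma) < size f)%N by rewrite size_polyX.
have := hz _ _ sX1 sXm; rewrite /petit_mul skew_rem_mulr mulrA.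
set a := skewX sigma * _ => E; rewrite -skew_rem_eq0.
have -> : (f : R) * z = a * z - (a - (f : R)) * z by rewrite mulrBl opprB addrC subrK.
rewrite skew_remD skew_remN -E subr_eq0; apply/eqP; congr (skew_rem f (_ * z)).
apply: (@skew_rem_unique 1); last by rewrite mul1r addrC subrK.
have -> : a = skewX sigma ^+ (size f).-1.
  by rewrite /a -exprS; congr (_ ^+ _); move: f2; case: (size f) => [|[]].
suff: (size (skewX sigma ^+ (size f).-1 - (f : R))%R <= (size f).-1)%N.
  by move: f2; case: (size f) => [|[]].
apply/leq_sizeP => j lej; rewrite skew_coefB -[_ ^+ _]mulr1 skew_coefXnM ltnNge lej /=.
have [->|ne] := eqVneq j (size f).-1.
  by rewrite subnn coef1 iters1 monic_skew_lead subrr.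
rewrite [f`_j]nth_default; last first.
  by move: f2 lej ne; move: (size f) => c; clear; lia.
rewrite coef1 subr0; case: eqP => [e|_]; last by rewrite iters0.
by move: ne lej e; move: (size f) => c; clear; lia.
Qed.

(* The right action (a + Rf) z = a z + Rf of Nuc_r(S_f) on R / Rf. *)
Definition nucr_act (z : nucr) (v : lquot (f : R)) : lquot (f : R) :=
  \pi_(lquot (f : R)) (repr v * val z).

Lemma nucr_actE (z : nucr) a : (1 < skew_deg f)%N ->
  nucr_act z (\pi a) = \pi_(lquot (f : R)) (a * val z).
Proof.
move=> m1; apply/eqP; rewrite /nucr_act lquot_eqE -mulrBl.
have : repr (\pi_(lquot (f : R)) a) - a \in lideal (f : R).
  by rewrite -lquot_eqE reprK.
case/lidealP=> q ->; have := valP z; rewrite right_nucleusE // => /andP[_].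
by rewrite -mulrA; apply: lideal_mull.
Qed.

End Petit.

(* Dimensions of a subset W of V over K, for a scalar operation act.  The
   operation is explicit because left and right scalars, and several scalar
   rings, occur on the same types. *)
Section Dimension.
Variables (K : nzRingType) (V : zmodType) (act : K -> V -> V).

Definition lincomb r (c : 'I_r -> K) (e : 'I_r -> V) := \sum_i act (c i) (e i).

Definition is_basis (W : set V) r (e : 'I_r -> V) :=
  (forall v, W v <-> exists c, v = lincomb c e) /\
  (forall c, lincomb c e = 0 -> forall i, c i = 0).

Definition has_dim (W : set V) r := exists e : 'I_r -> V, is_basis W e.

Definition is_subspace (W : set V) :=
  W 0 /\ forall c x y, W x -> W y -> W (act c x + y).

End Dimension.

(* Rank-metric codes in M_k(B), linear over a field K mapped into B by iota. *)
Section RankCodes.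
Variables (B : nzRingType) (k : nat).
Implicit Types (X Y : 'M[B]_k) (code : set 'M[B]_k).

Definition col_rscale (b : B) (v : 'cV[B]_k) : 'cV[B]_k := \col_i (v i 0 * b).

Definition colspace X : set 'cV[B]_k :=
  [set v | exists c : 'I_k -> B, v = lincomb col_rscale c (fun j => col j X)].

Definition has_rank_dist X Y r := has_dim col_rscale (colspace (X - Y)) r.

Definition is_min_dist code delta :=
  (exists X Y, [/\ code X, code Y, X <> Y & has_rank_dist X Y delta]) /\
  (forall X Y r, code X -> code Y -> X <> Y -> has_rank_dist X Y r ->
     (delta <= r)%N).

Variables (K : fieldType) (iota : {rmorphism K -> B}).

Definition code_scale (c : K) X : 'M[B]_k := iota c *: X.

Definition is_linear_code code := is_subspace code_scale code.

(* delta <= k always holds here, so the truncated k - delta is harmless. *)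
Definition is_MRD code :=
  is_linear_code code /\
  exists N b delta,
    [/\ has_dim code_scale code N,
        has_dim (fun (c : K) (x : B) => iota c * x) setT b,
        is_min_dist code delta
      & N = (k * (k - delta + 1) * b)%N].

End RankCodes.

Section SkewDivision.
Variables (C : fieldType) (D : falgType C) (sigma : {rmorphism D -> D}).
Local Notation R := (skewpoly sigma).

Definition inner (tau : D -> D) :=
  exists2 v : D, v \is a GRing.unit & forall z, tau z = v * z * v^-1.

(* F = C \cap Fix(sigma), for the center C of D. *)
Definition fixF : fieldType := fixfield (in_alg D) sigma.

Definition fixF_in : {rmorphism fixF -> D} := in_alg D \o val.

Definition fixF' (rho : {rmorphism D -> D}) : fieldType := fixfield fixF_in rho.

(* hhat(u^-1 t^n) *)
Definition central_eval (u : D) n (hhat : {poly fixF}) : R :=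
  (map_poly (skewC sigma \o fixF_in) hhat).[skewC sigma u^-1 * skewX sigma ^+ n].

Definition min_central_left_multiple u n (f : R) (hhat : {poly fixF}) :=
  let h := central_eval u n hhat in
  [/\ hhat \is monic, nc_central h, h \in lideal f
    & forall g : R, nc_central g -> g <> 0 -> g \in lideal f ->
        (skew_deg h <= skew_deg g)%N].

(* With N = l m: d_0 + ... + d_{N-1} t^{N-1} + nu rho(d_0) t^N. *)
Definition mrd_polys (nu : D) (rho : D -> D) N : set R :=
  [set a | exists d : nat -> D,
     a = \sum_(i < N) skewC sigma (d i) * skewX sigma ^+ i
         + skewC sigma (nu * rho (d 0%N)) * skewX sigma ^+ N].

Section Nucleus.
Variable f : monic_skewpoly sigma.

Fact nucr_const_proof (c : fixF) : skewC sigma (fixF_in c) \in right_nucleus f.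
Proof.
have f1 := monic_skew_size f.
set z : R := skewC _ _.
have cz : nc_central z.
  move=> y; apply: skewP => i; rewrite skew_coefCM skew_coefMC.
  have -> : iter i sigma (fixF_in c) = fixF_in c.
    by elim: i => // i IH; rewrite iterS IH; apply/eqP; apply: (valP c).
  by rewrite /= -scalerAl -scalerAr mul1r mulr1.
have sz : (size z <= 1)%N by rewrite size_polyC leq_b1.
apply/right_nucleusP; split; first exact: leq_ltn_trans sz f1.
move=> a b _ _; rewrite /petit_mul skew_rem_mulr -cz -[b * z]cz mulrA -cz -mulrA.
by rewrite skew_rem_mulr.
Qed.

Definition nucr_const (c : fixF) : nucr f := NucR (nucr_const_proof c).

Fact nucr_const_zmod_morphism : zmod_morphism nucr_const.
Proof.
by move=> a b; apply: val_inj; apply: (rmorphB (skewC sigma \o fixF_in)).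
Qed.

Fact nucr_const_monoid_morphism : monoid_morphism nucr_const.
Proof.
split=> [|a b]; apply: val_inj; first exact: (rmorph1 (skewC sigma \o fixF_in)).
have E := rmorphM (skewC sigma \o fixF_in) a b.
rewrite [LHS]E /= /petit_mul -[X in skew_rem f X]E skew_rem_id //.
by rewrite (leq_ltn_trans _ (monic_skew_size f)) // size_polyC leq_b1.
Qed.

HB.instance Definition _ := GRing.isZmodMorphism.Build fixF (nucr f) nucr_const
  nucr_const_zmod_morphism.
HB.instance Definition _ := GRing.isMonoidMorphism.Build fixF (nucr f)
  nucr_const nucr_const_monoid_morphism.

Definition right_basis r (e : 'I_r -> lquot (f : R)) :=
  is_basis (@nucr_act _ _ f) setT e.

(* M_a has as its j-th column the coordinates of L_a (e j) = a e_j. *)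
Definition skew_code (P : set R) r (e : 'I_r -> lquot (f : R)) :
    set 'M[nucr f]_r :=
  [set M | exists2 a, P a & forall j, a *: e j = \sum_i nucr_act (M i j) (e i)].

End Nucleus.

End SkewDivision.

(* Main.v *)
Require Import Defs.
From HB Require Import structures.
From mathcomp Require Import all_boot all_order all_algebra all_field.
From mathcomp Require Import zify.
From mathcomp Require Import boolp classical_sets.

(** Let V = R / Rf, m = deg f and t the variable of R.  Since f is irreducible,
    V is a simple left R-module, and B, acting on the right, is its endomorphism
    ring, a division ring by Schur's lemma ([nucr_division]).  All the ranks in
    the theorem are read off from one fact ([family_annihilator]): the
    polynomials that kill j vectors of V independent over B form a left ideal Rg
    with deg g = j m.  It follows from Jacobson density ([density]) by induction
    on j, because the annihilator of one nonzero vector has a generator of degree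
    m ([annihilator_generator]).

    Dimension of V.  The polynomials that kill V form a two-sided ideal with a
    central generator ([annihilator_central]), which must be h, up to a unit, by
    the minimality of h ([mclm_annihilator]); so deg h = m dim_B V.  An
    irreducible factor p of a generator of the annihilator of some vectors of V
    is similar to f ([irreducible_factor_annihilator]), hence of degree m.  So
    the number k of irreducible factors of h is dim_B V ([factorization_dim]).

    Minimum distance.  The column rank of M_a is the dimension of the range of
    L_a, so it is k minus the dimension of the kernel of L_a.  If a nonzero a in
    P, of degree at most l m, kills l independent vectors, then its degree is l m
    and it generates their annihilator, so that all its irreducible factors are
    similar to f, which is excluded ([kernel_dim_lt]).  So all ranks are at least
    k - l + 1.  Conversely, given l - 1 vectors e_i of a basis, some nonzero s of
    degree at most (l - 1) m kills the vectors t e_i; then s t, of degree less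
    than l m since m > 1, is in P and kills the e_i, so that its rank is
    k - l + 1 ([code_low_rank], [code_min_dist]).

    Dimension of the code.  The map from a to M_a is injective on P, which has
    dimension l m [D : F'] over F', and the dimension of V over F' is m [D : F']
    as well as k [B : F']; so the code has dimension l k [B : F'], which is the
    Singleton-like bound.  These dimensions are finite because [C : F] <= n, by
    Artin's argument ([center_degree_leq]).

    The case deg h = d m n.  As deg h = k m, k = d n.  Evaluation at u^-1 t^n
    embeds F[x] / (hhat) in B ([central_qpoly_inj]).  It is onto because of
    dimensions: m [D : F'] = d n [B : F'] and [C : F] <= n give
    [B : F'] <= d m [F : F'], and d m is the degree of hhat
    ([central_qpoly_bij]).  The code is then transported along the isomorphism
    ([map_code_MRD], [map_code_min_dist]). *)

Set Implicit Arguments.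
Unset Strict Implicit.
Unset Printing Implicit Defensive.

Import GRing.Theory.
Local Open Scope ring_scope.
Local Open Scope quotient_scope.

(** * Linear algebra over a division ring *)

Definition division_ring (K : nzRingType) :=
  forall a : K, a != 0 -> exists b, b * a = 1.

Lemma division_inv (K : nzRingType) (a : K) :
  division_ring K -> a != 0 -> exists b, b * a = 1 /\ a * b = 1.
Proof.
move=> divK a0; have [b ba] := divK a a0.
have b0 : b != 0 by apply: contraNneq (oner_neq0 K) => e; rewrite -ba e mul0r.
have [c cb] := divK b b0; exists b.
suff e : c = a by rewrite -[in a * b]e.
by rewrite -[LHS]mulr1 -ba mulrA cb mul1r.
Qed.

Lemma division_ring_conv (K : nzRingType) :
  division_ring K -> division_ring K^c.
Proof. by move=> divK a /(division_inv divK)[b [_ ab]]; exists b. Qed.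

Section HomogeneousSystem.
Variables (K : nzRingType) (divK : division_ring K).

(** Gaussian elimination: if the last equation has a nonzero coefficient, it is
    solved for the corresponding unknown. The unknowns are on the left, as the
    coefficients of vectors in a left module are. *)
Lemma homogeneous_system r s (A : 'I_s -> 'I_r -> K) : (r < s)%N ->
  exists c : 'I_s -> K, (exists i, c i != 0) /\ forall j, \sum_i c i * A i j = 0.
Proof.
elim: r s A => [|r IH] [|s] A // lt_rs.
  exists (fun=> 1); split; first by exists ord0; rewrite oner_neq0.
  by case.
have [A0|/existsNP[i0 /eqP a0]] := pselect (forall i, A i ord_max = 0).
  have [|c [c0 Ec]] := IH s.+1 (fun i j => A i (lift ord_max j)).
    exact: ltnW.
  exists c; split=> // j; have [->|ne] := eqVneq j ord_max.
    by rewrite big1 // => i _; rewrite A0 mulr0.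
  by case: (unliftP ord_max j) ne => [j' ->|->] //; rewrite ?eqxx // Ec.
have [b ba] := divK a0.
(* The system left after the unknown i0 is eliminated by the last equation. *)
pose A' i j := A (lift i0 i) (lift ord_max j)
  - A (lift i0 i) ord_max * b * A i0 (lift ord_max j).
have [//|c [[i ci0] Ec]] := IH s A'.
pose cb := - \sum_i c i * A (lift i0 i) ord_max * b.
exists (fun i => if unlift i0 i is Some i' then c i' else cb); split.
  by exists (lift i0 i); rewrite liftK.
move=> j; rewrite (bigD1_ord i0) //= unlift_none.
under eq_bigr => i' _ do rewrite liftK.
case: (unliftP ord_max j) => [j' ->|->].
  rewrite -[RHS](Ec j') /cb mulNr mulr_suml -sumrN -big_split /=.
  by apply: eq_bigr => i' _; rewrite /A' mulrBr addrC !mulrA.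
rewrite /cb mulNr mulr_suml -sumrN -big_split /= big1 // => i' _.
by rewrite -[_ * b * _]mulrA ba mulr1 addNr.
Qed.

End HomogeneousSystem.

Definition rcons_fun (T : Type) r (c : 'I_r -> T) (a : T) (i : 'I_r.+1) :=
  if unlift ord_max i is Some k then c k else a.

Section Combinations.
Variables (K : nzRingType) (V : zmodType) (act : K -> V -> V).

(** The action is explicit, as in [lincomb]; a right action of K is a left
    action of the converse ring K^c, and so is covered as well. *)
Definition module_action :=
  [/\ forall v, act 1 v = v, forall a b v, act a (act b v) = act (a * b) v,
      forall v, {morph act^~ v : a b / a + b}
    & forall a, {morph act a : v w / v + w}].

Definition independent r (e : 'I_r -> V) :=
  forall c, lincomb act c e = 0 -> forall i, c i = 0.

Definition lin_span r (e : 'I_r -> V) : set V :=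
  [set v | exists c, v = lincomb act c e].

Lemma lincomb_recr r (c : 'I_r.+1 -> K) e : lincomb act c e =
  lincomb act (c \o lift ord_max) (e \o lift ord_max) + act (c ord_max) (e ord_max).
Proof. by rewrite /lincomb (bigD1_ord ord_max) //= addrC. Qed.

Lemma lincomb_rcons r (c : 'I_r -> K) a (e : 'I_r.+1 -> V) :
  lincomb act (rcons_fun c a) e =
  lincomb act c (e \o lift ord_max) + act a (e ord_max).
Proof.
rewrite lincomb_recr /rcons_fun unlift_none; congr (_ + _).
by apply: eq_bigr => i _; rewrite /= liftK.
Qed.

Lemma has_dim_fin (W : set V) (I : finType) (e : I -> V) :
  (forall v, W v <-> exists c : I -> K, v = \sum_i act (c i) (e i)) ->
  (forall c : I -> K, \sum_i act (c i) (e i) = 0 -> forall i, c i = 0) ->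
  has_dim act W #|I|.
Proof.
move=> spanW ind; pose to_fin (c : 'I_#|I| -> K) i := c (enum_rank i).
have E c : lincomb act c (e \o enum_val) = \sum_i act (to_fin c i) (e i).
  rewrite [RHS](reindex _ (onW_bij _ (@enum_val_bij I))) /=.
  by apply: eq_bigr => i _; rewrite /to_fin enum_valK.
exists (e \o enum_val); split=> [v|c].
  split=> [/spanW[c ->]|[c ->]]; last by apply/spanW; rewrite E; exists (to_fin c).
  exists (c \o enum_val); rewrite E; apply: eq_bigr => i _.
  by rewrite /to_fin /= enum_rankK.
rewrite E => /ind c0 i; have := c0 (enum_val i).
by rewrite /to_fin enum_valK.
Qed.

Hypothesis actP : module_action.

Let act1 v : act 1 v = v. Proof. by case: actP. Qed.
Let actA a b v : act a (act b v) = act (a * b) v.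
Proof. by case: actP => _ + _ _; apply. Qed.
Let actDl v a b : act (a + b) v = act a v + act b v.
Proof. by case: actP => _ _ + _; apply. Qed.
Let actDr a v w : act a (v + w) = act a v + act a w.
Proof. by case: actP => _ _ _; apply. Qed.

Lemma act0l v : act 0 v = 0.
Proof. by apply: (addIr (act 0 v)); rewrite -actDl !add0r. Qed.

Lemma act0r a : act a 0 = 0.
Proof. by apply: (addIr (act a 0)); rewrite -actDr !add0r. Qed.

Lemma actNl a v : act (- a) v = - act a v.
Proof. by apply: (addIr (act a v)); rewrite -actDl !addNr act0l. Qed.

Lemma act_suml I (s : seq I) (P : pred I) (c : I -> K) v :
  act (\sum_(i <- s | P i) c i) v = \sum_(i <- s | P i) act (c i) v.
Proof. exact: (big_morph (act^~ v) (actDl v) (act0l v)). Qed.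

Lemma act_sumr I (s : seq I) (P : pred I) a (v : I -> V) :
  act a (\sum_(i <- s | P i) v i) = \sum_(i <- s | P i) act a (v i).
Proof. exact: (big_morph (act a) (actDr a) (act0r a)). Qed.

Lemma lincombD r (c c' : 'I_r -> K) e :
  lincomb act (fun i => c i + c' i) e = lincomb act c e + lincomb act c' e.
Proof. by rewrite /lincomb -big_split; apply: eq_bigr => i _; rewrite actDl. Qed.

Lemma lincombZ r a (c : 'I_r -> K) e :
  lincomb act (fun i => a * c i) e = act a (lincomb act c e).
Proof. by rewrite /lincomb act_sumr; apply: eq_bigr => i _; rewrite actA. Qed.

Lemma span_mem r (e : 'I_r -> V) i : lin_span e (e i).
Proof.
exists (fun j => (j == i)%:R); rewrite /lincomb (bigD1 i) //= eqxx act1.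
by rewrite big1 ?addr0 // => j /negPf->; rewrite act0l.
Qed.

Lemma subspace_lincomb W r (e : 'I_r -> V) c :
  is_subspace act W -> (forall i, W (e i)) -> W (lincomb act c e).
Proof.
by case=> W0 WD We; rewrite /lincomb; elim/big_ind: _ => // [x y Wx Wy|i _];
   [rewrite -[x]act1 | rewrite -[act _ _]addr0]; apply: WD.
Qed.

Lemma is_subspace_lin_span r (e : 'I_r -> V) : is_subspace act (lin_span e).
Proof.
split=> [|a _ _ [c ->] [c' ->]].
  by exists (fun=> 0); rewrite /lincomb big1 // => i _; rewrite act0l.
by exists (fun i => a * c i + c' i); rewrite lincombD lincombZ.
Qed.

Lemma has_dim_subspace W r : has_dim act W r -> is_subspace act W.
Proof.
case=> e [We _]; have [W0 WD] := is_subspace_lin_span e.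
by split=> [|a x y /We Sx /We Sy]; apply/We; [apply: W0 | apply: WD].
Qed.

Hypothesis divK : division_ring K.

(** Steinitz: the coordinates of more than r vectors on r spanning vectors form
    a homogeneous system with a nonzero solution. *)
Lemma independent_leq_span r s (e : 'I_r -> V) (x : 'I_s -> V) :
  (forall i, lin_span e (x i)) -> independent x -> (s <= r)%N.
Proof.
move=> /fin_all_exists[A Ax] ind; rewrite leqNgt; apply/negP => lt_rs.
have [c [[i /eqP ci0] Ec]] := homogeneous_system divK A lt_rs.
apply: ci0; apply: ind; rewrite /lincomb.
under eq_bigr => j _ do rewrite Ax act_sumr.
rewrite exchange_big big1 //= => j _.
by under eq_bigr => k _ do rewrite actA; rewrite -act_suml Ec act0l.
Qed.

Lemma independent_rcons r (e : 'I_r -> V) v : independent e -> ~ lin_span e v ->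
  independent (rcons_fun e v).
Proof.
move=> ind nv c; rewrite lincomb_recr /rcons_fun unlift_none.
set y := lincomb _ _ _; have Ey : y = lincomb act (c \o lift ord_max) e.
  by apply: eq_bigr => i _; rewrite /= liftK.
move=> E; have cm : c ord_max = 0.
  apply/eqP; apply: contra_notT nv => /divK[b bc].
  exists (fun i => (- b) * c (lift ord_max i)); rewrite lincombZ -Ey.
  rewrite actNl -[LHS]act1 -bc -actA; apply/eqP; rewrite -addr_eq0 -actDr addrC.
  by rewrite E act0r.
move: E; rewrite cm act0l addr0 Ey => /ind c0 i.
by case: (unliftP ord_max i) => [j ->|->]; rewrite ?cm //; apply: c0.
Qed.

(** An independent family of maximal size spans W, since any vector outside its
    span could be appended to it. *)
Lemma bounded_has_dim W N : is_subspace act W ->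
  (forall r (e : 'I_r -> V), (forall i, W (e i)) -> independent e -> (r <= N)%N) ->
  exists2 r, (r <= N)%N & has_dim act W r.
Proof.
move=> sW bndW.
pose Q r := `[< exists e : 'I_r -> V, (forall i, W (e i)) /\ independent e >].
have Q0 : exists r, Q r.
  exists 0%N; apply/asboolP; exists (fun i => 0); split; first by case.
  by move=> c _; case.
have QN r : Q r -> (r <= N)%N by case/asboolP=> e [We ind]; apply: bndW ind.
have [r /asboolP[e [We ind]] maxr] := ex_maxnP Q0 QN.
exists r; first exact: bndW ind.
exists e; split=> // v; split=> [Wv|[c ->]]; last exact: subspace_lincomb.
apply: contrapT => nv; suff: Q r.+1 by move/maxr; rewrite ltnn.
apply/asboolP.
exists (rcons_fun e v).
by split=> [i|]; [rewrite /rcons_fun; case: unliftP | apply: independent_rcons].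
Qed.

Lemma has_dim_bound W r s (x : 'I_s -> V) :
  has_dim act W r -> (forall i, W (x i)) -> independent x -> (s <= r)%N.
Proof.
by case=> e [We _] Wx; apply: (@independent_leq_span _ _ e) => i; apply/We.
Qed.

Lemma has_dim_sub_leq W U r s : (W `<=` U)%classic ->
  has_dim act W r -> has_dim act U s -> (r <= s)%N.
Proof.
move=> WU [e [We ind]] dU; apply: has_dim_bound dU _ ind => i.
by apply: WU; apply/We; apply: span_mem.
Qed.

Lemma has_dim_unique W r s : has_dim act W r -> has_dim act W s -> r = s.
Proof. by move=> dr ds; apply/eqP; rewrite eqn_leq !(@has_dim_sub_leq W W). Qed.

Lemma has_dim_sub_eq W U r : (W `<=` U)%classic ->
  has_dim act W r -> has_dim act U r -> W = U.
Proof.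
move=> WU [e [We ind]] dU; apply/seteqP; split=> // v Uv.
apply/We; apply: contrapT => nv.
suff /(has_dim_bound dU)/(_ (independent_rcons ind nv)) :
    forall i, U (rcons_fun e v i) by rewrite ltnn.
move=> i; rewrite /rcons_fun; case: unliftP => // j _.
by apply: WU; apply/We; apply: span_mem.
Qed.

Lemma subspace_has_dim W U r : (W `<=` U)%classic -> is_subspace act W ->
  has_dim act U r -> exists s, has_dim act W s.
Proof.
move=> WU sW dU; have [s x Wx ind|s _ dW] := @bounded_has_dim W r sW; last by exists s.
by apply: has_dim_bound dU _ ind => i; apply/WU/Wx.
Qed.

(** A basis of the kernel and preimages of a basis of the range form a basis. *)
Lemma rank_nullity (phi : V -> V) k j r :
  {morph phi : x y / x + y} -> (forall a v, phi (act a v) = act a (phi v)) ->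
  has_dim act setT k -> has_dim act [set v | phi v = 0]%classic j ->
  has_dim act (range phi) r -> k = (j + r)%N.
Proof.
move=> phiD phiA dV [e [ke inde]] [y [ry indy]].
have phi0 : phi 0 = 0 by apply: (addIr (phi 0)); rewrite -phiD !add0r.
have phi_comb s (c : 'I_s -> K) x : phi (lincomb act c x) = lincomb act c (phi \o x).
  by rewrite /lincomb (big_morph phi phiD phi0); apply: eq_bigr => i _; rewrite phiA.
have /fin_all_exists[x Ex] i : exists x, phi x = y i.
  by have /ry[x _ <-] := span_mem y i; exists x.
have {}Ex : phi \o x = y by apply/funext => i; apply: Ex.
pose ex (i : 'I_(j + r)) := match split i with inl i => e i | inr i => x i end.
have comb_ex c : lincomb act c ex =
    lincomb act (c \o @lshift j r) e + lincomb act (c \o @rshift j r) x.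
  rewrite /lincomb big_split_ord /=; congr (_ + _); apply: eq_bigr => i _.
    by rewrite /ex (unsplitK (inl i)).
  by rewrite /ex (unsplitK (inr i)).
apply: has_dim_unique dV _; exists ex; split=> [v|c]; last first.
  rewrite comb_ex => E; have phie : phi (lincomb act (c \o @lshift j r) e) = 0.
    by apply/ke; eexists.
  have cr : forall i, c (rshift j i) = 0.
    by apply: indy; rewrite -Ex -phi_comb -[RHS]phi0 -E phiD phie add0r.
  have cl : forall i, c (lshift r i) = 0.
    apply: inde; rewrite -[RHS]E -[LHS]addr0; congr (_ + _).
    by rewrite /lincomb big1 // => i _; rewrite /= cr act0l.
  by move=> i; case: (splitP i) => i' Ei; [rewrite -(cl i') | rewrite -(cr i')];
    congr c; apply: val_inj.
split=> // _; have /ry[c Ec] : range phi (phi v) by exists v.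
have /ke[c' Ec'] : phi (v + act (-1) (lincomb act c x)) = 0.
  by rewrite phiD phiA phi_comb Ex -Ec -{1}[phi v]act1 -actDl subrr act0l.
exists (fun i => match split i with inl i => c' i | inr i => c i end).
rewrite comb_ex -[LHS](subrK (lincomb act c x)) -[X in _ - X]act1 -actNl Ec'.
congr (_ + _); apply: eq_bigr => i _ /=.
  by rewrite (unsplitK (inl i)).
by rewrite (unsplitK (inr i)).
Qed.

End Combinations.

(** The change of scalars theta makes one statement serve for coordinates and for
    embeddings, where it is the identity, and for column spaces under a ring
    isomorphism, where the scalars change too. *)
Lemma has_dim_image (K1 K2 : nzRingType) (V1 V2 : zmodType)
    (act1 : K1 -> V1 -> V1) (act2 : K2 -> V2 -> V2)
    (theta : K1 -> K2) (phi : V1 -> V2) (W : set V1) r :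
  module_action act2 -> bijective theta -> theta 0 = 0 ->
  zmod_morphism phi -> injective phi ->
  (forall a v, phi (act1 a v) = act2 (theta a) (phi v)) ->
  has_dim act2 (phi @` W)%classic r <-> has_dim act1 W r.
Proof.
move=> act2P [eta thK etK] th0 phiB phiI phiA.
have phi0 : phi 0 = 0 by rewrite -{1}(subrr 0) phiB subrr.
have phiN x : phi (- x) = - phi x by rewrite -[- x]add0r phiB phi0 add0r.
have phiD : {morph phi : x y / x + y}.
  by move=> x y; rewrite -{1}[y]opprK phiB phiN opprK.
have E c (e : 'I_r -> V1) :
    phi (lincomb act1 c e) = lincomb act2 (theta \o c) (phi \o e).
  by rewrite /lincomb (big_morph phi phiD phi0); apply: eq_bigr.
have key (e : 'I_r -> V1) :
    is_basis act2 (phi @` W)%classic (phi \o e) <-> is_basis act1 W e.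
  split=> -[sp ind]; split=> [v|c].
  - split=> [Wv|[c Ev]].
      have /sp[c Ec] : (phi @` W)%classic (phi v) by exists v.
      exists (eta \o c); apply: phiI; rewrite E Ec.
      by apply: eq_bigr => i _; rewrite /= etK.
    have /sp[w Ww /phiI <-//] :
      exists c, phi v = lincomb act2 c (phi \o e).
    by exists (theta \o c); rewrite Ev E.
  - move=> c0 i; rewrite -[c i]thK -[RHS]thK th0; congr eta.
    by apply: (ind (theta \o c)); rewrite -E c0.
  - split=> [[w /sp[c ->] <-]|[c ->]]; first by exists (theta \o c); rewrite E.
    exists (lincomb act1 (eta \o c) e); first by apply/sp; exists (eta \o c).
    by rewrite E; apply: eq_bigr => i _; rewrite /= etK.
  - move=> c0 i; rewrite -[c i]etK; suff -> : eta (c i) = 0 by [].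
    apply: (ind (eta \o c)); apply: phiI; rewrite phi0 E -[RHS]c0.
    by apply: eq_bigr => j _; rewrite /= etK.
split=> [[y by_]|[e be]]; last by exists (phi \o e); apply/key.
suff /fin_all_exists[e Ee] i : exists x, phi x = y i.
  exists e; apply/key; suff -> : phi \o e = y by [].
  by apply/funext => i; rewrite /= Ee.
have [sp _] := by_.
by have /sp[x _ <-] := span_mem act2P y i; exists x.
Qed.

(** The products of the elements of the two bases form a basis. The scalar
    operations are kept independent, and only related by the compatibility of
    act1, act2 and scal, so that left and right actions can be mixed. *)
Lemma has_dim_tower (K1 K2 : nzRingType) (V : zmodType)
    (scal : K1 -> K2 -> K2) (act1 : K1 -> V -> V) (act2 : K2 -> V -> V)
    (W : set V) p s :
  (forall v, {morph act2^~ v : x y / x + y}) ->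
  (forall a, {morph act1 a : v w / v + w}) ->
  (forall a x v, act2 (scal a x) v = act1 a (act2 x v)) ->
  has_dim scal setT p -> has_dim act2 W s -> has_dim act1 W (s * p).
Proof.
move=> act2D act1D act12 [b [sb ib]] [e [se ie]].
have act20 v : act2 0 v = 0.
  by apply: (addIr (act2 0 v)); rewrite -act2D !add0r.
have act10 a : act1 a 0 = 0.
  by apply: (addIr (act1 a 0)); rewrite -act1D !add0r.
pose be (i : 'I_s * 'I_p) := act2 (b i.2) (e i.1).
have E c : \sum_i act1 (c i) (be i)
    = lincomb act2 (fun j => lincomb scal (fun i => c (j, i)) b) e.
  transitivity (\sum_j \sum_i act1 (c (j, i)) (be (j, i))).
    by rewrite pair_bigA; apply: eq_bigr => -[].
  rewrite /lincomb; apply: eq_bigr => j _.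
  rewrite (big_morph (act2^~ (e j)) (act2D _) (act20 _)).
  by apply: eq_bigr => i _; rewrite act12.
have -> : (s * p = #|{: 'I_s * 'I_p}|)%N by rewrite card_prod !card_ord.
apply: (has_dim_fin (e := be)) => [v|c]; last first.
  by rewrite E => /ie c0 [j i]; have := c0 j => /ib.
split=> [/se[x ->]|[c ->]]; last by rewrite E; apply/se; eexists.
have /fin_all_exists[c Ec] j : exists c, x j = lincomb scal c b by apply/sb.
exists (fun i => c i.1 i.2); rewrite E; apply: eq_bigr => j _.
by rewrite Ec.
Qed.

Lemma mulr_module_action (K B : nzRingType) (iota : {rmorphism K -> B}) :
  module_action (fun c x => iota c * x).
Proof.
split=> [x|a c x|x a c|a x y].
- by rewrite rmorph1 mul1r.
- by rewrite mulrA rmorphM.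
- by rewrite rmorphD mulrDl.
- by rewrite mulrDr.
Qed.

Lemma code_scale_action (B : nzRingType) k (K : fieldType)
    (iota : {rmorphism K -> B}) : module_action (@code_scale B k K iota).
Proof.
split=> [X|a c X|X a c|a X Y]; rewrite /code_scale.
- by rewrite rmorph1 scale1r.
- by rewrite scalerA rmorphM.
- by rewrite rmorphD scalerDl.
- by rewrite scalerDr.
Qed.

(** * Skew polynomials over a division ring *)

Section LeftIdeals.
Variables (D : nzRingType) (divD : division_ring D) (sigma : {rmorphism D -> D}).
Local Notation R := (skewpoly sigma).
Implicit Types (p q r g f : R).

Lemma division_mulf_eq0 (a b : D) : a * b = 0 -> a = 0 \/ b = 0.
Proof.
move=> ab; have [->|/divD[c ca]] := eqVneq a 0; [by left | right].
by rewrite -[b]mul1r -ca -mulrA ab mulr0.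
Qed.

Lemma iter_rmorph_eq0 j (a : D) : iter j sigma a = 0 -> a = 0.
Proof.
move=> sa; have [//|/divD[c ca]] := eqVneq a 0.
have := oner_neq0 D; rewrite -(iters1 sigma j) -ca itersM sa mulr0.
by rewrite eqxx.
Qed.

Lemma skew_size_eq0 p : (size p == 0)%N = (p == 0).
Proof. by rewrite size_poly_eq0. Qed.

Lemma skew_size_gt0 p : (0 < size p)%N = (p != 0).
Proof. by rewrite lt0n skew_size_eq0. Qed.

Lemma skew_lead_neq0 p : p != 0 -> p`_(size p).-1 != 0.
Proof. by move=> p0; rewrite -lead_coefE lead_coef_eq0. Qed.

(** When i and j bound the two degrees, only one term of the convolution is left;
    for i and j the degrees themselves it is the leading coefficient. *)
Lemma skew_coef_mul_top p q i j : (size p <= i.+1)%N -> (size q <= j.+1)%N ->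
  (p * q)`_(i + j) = p`_i * iter i sigma q`_j.
Proof.
move=> pi qj; have lt_i : (i < (i + j).+1)%N by lia.
rewrite skew_coefM (bigD1 (Ordinal lt_i)) //= addKn big1 ?addr0 // => k.
rewrite -val_eqE /= => ne; have [lt_ki|le_ik] := ltnP k i.
  by rewrite [q`__]nth_default ?iters0 ?mulr0 // (leq_trans qj) //; lia.
by rewrite nth_default ?mul0r // (leq_trans pi) //; lia.
Qed.

Lemma skew_size_mul p q : p != 0 -> q != 0 ->
  size (p * q : R) = (size p + size q).-1.
Proof.
rewrite -!skew_size_gt0 => p0 q0.
have le : (size (p * q : R)%R <= (size p + size q).-1)%N by apply: size_poly.
apply/eqP; rewrite eqn_leq le /=; suff : (p * q)`_((size p).-1 + (size q).-1) != 0.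
  rewrite leqNgt; apply: contraNN => lt; apply/eqP/nth_default; move: lt p0 q0 {le}.
  by move: (size p) (size q) (size _) => a b c; clear; lia.
rewrite skew_coef_mul_top ?prednK //; apply/eqP => /division_mulf_eq0.
by case=> [|/iter_rmorph_eq0] /eqP; apply/negP/skew_lead_neq0;
  rewrite -skew_size_gt0.
Qed.

Lemma skew_mulf_neq0 p q : p != 0 -> q != 0 -> p * q != 0.
Proof.
move=> p0 q0; rewrite -skew_size_gt0 skew_size_mul //.
by move: p0 q0; rewrite -!skew_size_gt0; lia.
Qed.

Lemma skew_mulf_eq0 p q : p * q = 0 -> p = 0 \/ q = 0.
Proof.
move=> /eqP pq; have [->|p0] := eqVneq p 0; first by left.
have [->|q0] := eqVneq q 0; first by right.
by rewrite (negPf (skew_mulf_neq0 p0 q0)) in pq.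
Qed.

Lemma skew_size1P p : size p = 1%N -> exists2 c, c != 0 & p = skewC sigma c.
Proof.
move/eqP/size_poly1P=> [c c0 Ep]; exists c => //.
by apply: val_inj; rewrite /= Ep.
Qed.

Lemma skew_nc_unitP p : nc_unit p <-> size p = 1%N.
Proof.
split=> [[q [pq _]]|/skew_size1P[c c0 ->]].
  have p0 : p != 0 by apply: contraNneq (oner_neq0 R) => e; rewrite -pq e mul0r.
  have q0 : q != 0 by apply: contraNneq (oner_neq0 R) => e; rewrite -pq e mulr0.
  have := skew_size_mul p0 q0; rewrite pq size_poly1.
  by move: p0 q0; rewrite -!skew_size_gt0; lia.
have [b [bc cb]] := division_inv divD c0.
by exists (skewC sigma b); rewrite -!rmorphM bc cb rmorph1.
Qed.

Lemma skew_make_monic q : q != 0 ->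
  exists c, [/\ c != 0, skew_monic (skewC sigma c * q)
    & size (skewC sigma c * q : R) = size q].
Proof.
move=> q0; have [b bq] := divD (skew_lead_neq0 q0).
have b0 : b != 0 by apply: contraNneq (oner_neq0 D) => e; rewrite -bq e mul0r.
have sb : size (skewC sigma b * q : R) = size q.
  by rewrite skew_size_mul ?size_polyC ?b0 // -skew_size_gt0 size_polyC b0.
by exists b; split=> //; rewrite /skew_monic lead_coefE sb skew_coefCM bq.
Qed.

Lemma skew_division q p : q != 0 ->
  exists s r, p = s * q + r /\ (size r < size q)%N.
Proof.
move=> q0; have [c [c0 mq sq]] := skew_make_monic q0.
have [q1|q1] := leqP (size q) 1.
  have /skew_nc_unitP[q' [_ q'q]] : size q = 1%N.
    by apply/eqP; rewrite eqn_leq q1 skew_size_gt0.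
  exists (p * q'), 0; rewrite -mulrA q'q mulr1 addr0.
  by rewrite size_poly0 skew_size_gt0.
have mqP : skew_monic (skewC sigma c * q) && (0 < skew_deg (skewC sigma c * q)%R)%N.
  by rewrite mq /skew_deg sq -subn1 subn_gt0.
have [s Es] := skew_rem_eq (MonicSkewPoly mqP) p.
exists (s * skewC sigma c), (skew_rem (MonicSkewPoly mqP) p).
rewrite -mulrA; split=> //.
by have := skew_rem_size (MonicSkewPoly mqP) p; rewrite /= sq.
Qed.

Definition left_ideal (I : R -> Prop) :=
  I 0 /\ forall a x y, I x -> I y -> I (a * x + y).

(** Division with remainder by a nonzero element of minimal degree. *)
Lemma left_ideal_principal I : left_ideal I ->
  exists g, forall x, I x <-> x \in lideal g.
Proof.
move=> [I0 ID]; have [[g0 [Ig0 g00]]|none] :=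
    pselect (exists g, I g /\ g != 0); last first.
  exists 0 => x; split=> [Ix|/lidealP[q ->]]; last by rewrite mulr0.
  apply/lidealP; exists 0; rewrite mulr0; apply/eqP.
  by apply: contra_notT none => x0; exists x.
pose Q k := `[< exists g, [/\ I g, g != 0 & size g = k] >].
have [|k /asboolP[g [Ig g_0 sg]] mink] := @ex_minnP Q.
  by exists (size g0); apply/asboolP; exists g0.
exists g => x; split=> [Ix|/lidealP[q ->]]; last first.
  by rewrite -[_ * g]addr0; apply: ID.
apply/lidealP; have [q [r [Ex lt]]] := skew_division x g_0.
exists q; have [r0|r0] := eqVneq r 0; first by rewrite Ex r0 addr0.
have Ir : I r.
  suff -> : r = (- q) * g + x by apply: ID.
  by rewrite Ex mulNr addKr.
suff : (k <= size r)%N by rewrite leqNgt -sg lt.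
by apply: mink; apply/asboolP; exists r.
Qed.

Lemma irreducible_size_gt1 p : nc_irreducible p -> (1 < size p)%N.
Proof.
case=> /eqP p0 np _; rewrite ltn_neqAle skew_size_gt0 p0 andbT.
by apply/eqP => e; apply: np; apply/skew_nc_unitP.
Qed.

(** The generator of R r + R p is a right divisor of p, hence a unit or associated
    to p; the latter would put r in R p. In other words, R / R p is simple. *)
Lemma irreducible_bezout p r : nc_irreducible p -> r \notin lideal p ->
  exists s t, s * r + t * p = 1.
Proof.
move=> [p0 np irr] rp; pose I x := exists s t, x = s * r + t * p.
have [|g Ig] := @left_ideal_principal I.
  split=> [|a _ _ [s [t ->]] [s' [t' ->]]]; first by exists 0, 0; rewrite !mul0r addr0.
  by exists (a * s + s'), (a * t + t'); rewrite mulrDr !mulrDl !mulrA addrACA.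
have /Ig/lidealP[x Ex] : I p by exists 0, 1; rewrite mul0r mul1r add0r.
have /Ig/lidealP[y Ey] : I r by exists 1, 0; rewrite mul0r mul1r addr0.
suff /Ig[s [t E]] : 1 \in lideal g by exists s, t.
have [[x' [_ x'x]]|[g' [_ g'g]]] := irr _ _ Ex; last by apply/lidealP; exists g'.
case/negP: rp; apply/lidealP; exists (y * x').
by rewrite Ey Ex -!mulrA [x' * _]mulrA x'x mul1r.
Qed.

(** The left Ore condition with a degree bound, obtained from the Euclidean
    algorithm on c and q. The bound does the work of a comparison of dimensions
    over D. *)
Lemma skew_ore q (c : R) : q != 0 ->
  exists s : R, [/\ s != 0, (size s <= size q)%N & s * c \in lideal q].
Proof.
move: c; have [N] := ubnP (size q); elim: N q => // N IH q ltN c q0.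
have [x [r [Ec lt]]] := skew_division c q0.
have [r0|r0] := eqVneq r 0.
  exists 1; rewrite oner_neq0 size_poly1 skew_size_gt0 q0 mul1r; split=> //.
  by apply/lidealP; exists x; rewrite Ec r0 addr0.
(* s q = y r is a common left multiple of q and of the remainder r; y works. *)
have [|s [s0 le /lidealP[y Ey]]] := IH r _ q r0.
  by rewrite -ltnS (leq_trans _ ltN).
have y0 : y != 0.
  by apply: contraTneq (skew_mulf_neq0 s0 q0) => y0; rewrite Ey y0 mul0r eqxx.
exists y; split=> //.
  have := skew_size_mul s0 q0; rewrite Ey skew_size_mul //.
  move: le; move: y0 r0 s0 q0; rewrite -!skew_size_gt0.
  by move: (size y) (size r) (size s) (size q) => a b d e; clear; lia.
by apply/lidealP; exists (y * x + s); rewrite Ec mulrDr mulrDl Ey mulrA.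
Qed.

End LeftIdeals.

(** * The simple module R / Rf and its endomorphisms *)

Section LQuotTheory.
Variables (R : nzRingType) (f : R).

Lemma scale_pi a b : a *: (\pi b : lquot f) = \pi_(lquot f) (a * b).
Proof. exact: lquot_scaleE. Qed.

Lemma pi_eq0 a : (\pi_(lquot f) a == 0) = (a \in lideal f).
Proof. by rewrite -[0](raddf0 \pi_(lquot f)) lquot_eqE subr0. Qed.

Lemma scale_pi1 a : a *: (\pi 1 : lquot f) = \pi_(lquot f) a.
Proof. by rewrite scale_pi mulr1. Qed.

End LQuotTheory.

Section SimpleModule.
Variables (D : nzRingType) (divD : division_ring D) (sigma : {rmorphism D -> D}).
Variables (f : monic_skewpoly sigma) (f_deg : (1 < skew_deg f)%N).
Hypothesis f_irr : nc_irreducible (f : skewpoly sigma).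
Local Notation R := (skewpoly sigma).
Local Notation V := (lquot (f : R)).
Local Notation B := (nucr f).
Local Notation act := (@nucr_act D sigma f).

Lemma pi_rem p : \pi_V (skew_rem f p) = \pi_V p.
Proof.
apply/eqP; rewrite lquot_eqE; have [q Eq] := skew_rem_eq f p.
apply/lidealP; exists (- q); rewrite mulNr {2}Eq opprD addrC addrNK //.
Qed.

Lemma simple_cyclic (v w : V) : v != 0 -> exists r : R, r *: v = w.
Proof.
rewrite -[v]reprK -[w]reprK pi_eq0 => /(irreducible_bezout divD f_irr)[s [t E]].
exists (repr w * s); apply/eqP; rewrite scale_pi lquot_eqE.
apply/lidealP; exists (- (repr w * t)).
by rewrite mulNr -!mulrA -[X in _ - X]mulr1 -E mulrDr opprD addNKr.
Qed.

Lemma pi1_neq0 : (\pi 1 : V) != 0.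
Proof.
rewrite pi_eq0; apply/lidealP => -[q Eq]; have [_ nf _] := f_irr.
have q0 : q != 0 by apply: contraNneq (oner_neq0 R) => e; rewrite Eq e mul0r.
have := skew_mul_monic_size f q0; rewrite -Eq size_poly1 leqNgt.
by rewrite monic_skew_size.
Qed.

Lemma nucr_act_scale (z : B) (r : R) (v : V) : act z (r *: v) = r *: act z v.
Proof. by rewrite -[v]reprK scale_pi !nucr_actE // scale_pi mulrA. Qed.

Lemma nucr_act_additive (z : B) : {morph act z : v w / v + w}.
Proof.
move=> v w; rewrite -[v]reprK -[w]reprK -raddfD !nucr_actE //.
by rewrite mulrDl raddfD.
Qed.

(** Over the converse ring, because B acts on the right. *)
Lemma nucr_module_action : @module_action B^c V act.
Proof.
split=> [v|a b v|v a b|]; last exact: nucr_act_additive.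
- by rewrite -[v]reprK nucr_actE // mulr1.
- rewrite -[v]reprK !nucr_actE //; apply/eqP; rewrite lquot_eqE.
  by rewrite -mulrA -mulrBr lideal_mull //= -lquot_eqE pi_rem.
- by rewrite -[v]reprK !nucr_actE // [val _]raddfD mulrDr raddfD.
Qed.

(** An endomorphism of V is determined by the image w of the class of 1, and any w
    killed by f occurs; so the endomorphisms of V are the right multiplications
    by elements of B. *)
Lemma nucr_class (w : V) : (f : R) *: w = 0 ->
  exists z : B, w = \pi_V (val z).
Proof.
rewrite -[w]reprK scale_pi => /eqP; rewrite pi_eq0 => fw.
have [q Eq] := skew_rem_eq f (repr w).
have rz : skew_rem f (repr w) \in right_nucleus f.
  rewrite right_nucleusE // skew_rem_size /=.
  have -> : (f : R) * skew_rem f (repr w) = (f : R) * repr w - (f : R) * q * f.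
    by rewrite {2}Eq mulrDr mulrA addrC addKr.
  by rewrite rpredB // lideal_mull //; apply/lidealP; exists 1; rewrite mul1r.
exists (NucR rz); apply/eqP; rewrite lquot_eqE /= {1}Eq addrK.
by apply/lidealP; exists q.
Qed.

Lemma nucr_pi_neq0 (z : B) : z != 0 -> \pi_V (val z) != 0.
Proof.
move=> z0; rewrite pi_eq0 -skew_rem_eq0.
by have /right_nucleusP[sz _] := valP z; rewrite skew_rem_id.
Qed.

(** The vectors killed by z form a proper submodule of the simple module V. *)
Lemma nucr_act_inj (z : B) v : z != 0 -> act z v = 0 -> v = 0.
Proof.
move=> z0 zv; apply/eqP; apply: contraTT isT => v0 /=.
have [r Er] := simple_cyclic (\pi 1) v0.
have := nucr_pi_neq0 z0; rewrite -[val z]mul1r -nucr_actE // -Er.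
by rewrite nucr_act_scale zv scaler0 eqxx.
Qed.

(** Schur's lemma: the vector that z sends to the class of 1 is killed by f, and
    is the class of the inverse of z. *)
Lemma nucr_division : division_ring B.
Proof.
move=> z z0; have [r Er] := simple_cyclic (\pi 1) (nucr_pi_neq0 z0).
have fr : act z ((f : R) *: (\pi r : V)) = 0.
  rewrite scale_pi nucr_actE // -mulrA -!scale_pi Er scale_pi1.
  by apply/eqP; rewrite pi_eq0; apply/lidealP; exists 1; rewrite mul1r.
have [y Ey] := nucr_class (nucr_act_inj z0 fr).
exists y; apply/eqP; rewrite -subr_eq0; apply/negPn/negP => /nucr_pi_neq0.
rewrite !raddfB subr_eq0 /= pi_rem => /eqP; apply.
by rewrite -nucr_actE // -Ey nucr_actE // -scale_pi Er.
Qed.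

Lemma annihilator_left_ideal (w : V) : left_ideal (fun r : R => r *: w = 0).
Proof.
split=> [|a x y xw yw]; first by rewrite scale0r.
by rewrite scalerDl -scalerA xw yw scaler0 addr0.
Qed.

(** R / Rq and R / Rf are both isomorphic to V, so q and f have the same degree;
    the Ore condition, used once in each direction, gives the two inequalities. *)
Lemma annihilator_generator (w : V) : w != 0 ->
  exists q : R, [/\ q != 0, size q = size f
    & forall r : R, r *: w = 0 <-> r \in lideal q].
Proof.
move=> w0; have f0 : (f : R) != 0.
  by rewrite -skew_size_gt0 (ltn_trans _ (monic_skew_size f)).
have [q qP] := left_ideal_principal divD (annihilator_left_ideal w).
have [s [s0 le sw]] := skew_ore divD (repr w) f0.
have /qP/lidealP[x Ex] : s *: w = 0.
  by rewrite -[w]reprK scale_pi; apply/eqP; rewrite pi_eq0.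
have q0 : q != 0 by apply: contraNneq s0 => q0; rewrite Ex q0 mulr0.
have x0 : x != 0 by apply: contraNneq s0 => x0; rewrite Ex x0 mul0r.
exists q; split=> //; apply/eqP; rewrite eqn_leq; apply/andP; split.
  apply: leq_trans le; rewrite Ex skew_size_mul //.
  by move: x0; rewrite -skew_size_gt0; move: (size x) (size q) => a b; clear; lia.
have [c Ec] := simple_cyclic (\pi 1) w0.
have [t [t0 le' /qP]] := skew_ore divD c q0.
rewrite -scalerA Ec scale_pi1 => /eqP; rewrite pi_eq0 => /lidealP[y Ey].
have y0 : y != 0 by apply: contraNneq t0 => y0; rewrite Ey y0 mul0r.
by apply: leq_trans le'; rewrite Ey skew_mul_monic_size.
Qed.

(** Jacobson density for the simple module V. Let I be the set of the r that kill
    all the e i but the last, w. Since v is killed by all the r in I that kill w,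
    r w |-> r v is a well-defined endomorphism of V, that is, an element z of B;
    then v - w z is killed by I, and induction applies to it. *)
Lemma density j (e : 'I_j -> V) v :
  (forall r : R, (forall i, r *: e i = 0) -> r *: v = 0) ->
  @lin_span B V act j e v.
Proof.
have actP := nucr_module_action; have [act1 actA actDl actDr] := actP.
elim: j e v => [|j IH] e v annv.
  exists (fun=> 0); rewrite /lincomb big_ord0 -[LHS]scale1r; apply: annv.
  by case.
pose e' := e \o lift ord_max; pose w := e ord_max.
have all_e (r : R) : (forall i, r *: e' i = 0) -> r *: w = 0 ->
    forall i, r *: e i = 0.
  move=> re' rw i; case: (unliftP ord_max i) => [k|] ->; last exact: rw.
  exact: re'.
suff [z Iz] : exists z : B, forall r : R, (forall i, r *: e' i = 0) ->
    r *: v = r *: act z w.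
  have [|c Ec] := IH e' (v - act z w).
    by move=> r re'; rewrite scalerBr Iz // subrr.
  by exists (rcons_fun c z); rewrite lincomb_rcons -Ec subrK.
(* If I kills w, it kills v, and z = 0 will do; otherwise I w = V. *)
have [I0|] := pselect (forall r : R, (forall i, r *: e' i = 0) -> r *: w = 0).
  exists 0 => r re'; rewrite [act _ _](act0l actP) scaler0; apply: annv.
  by apply: all_e => //; apply: I0.
move=> /existsNP[r /not_implyP[re' /eqP rw]].
have [x Ex] := simple_cyclic (\pi 1) rw.
pose r0 := x * r.
have r0e i : r0 *: e' i = 0 by rewrite -scalerA re' scaler0.
have r0w : r0 *: w = \pi 1 by rewrite -scalerA Ex.
have [|z Ez] := @nucr_class (r0 *: v).
  rewrite scalerA; apply: annv; apply: all_e => [i|].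
    by rewrite -scalerA r0e scaler0.
  rewrite -scalerA r0w scale_pi1; apply/eqP; rewrite pi_eq0.
  by apply/lidealP; exists 1; rewrite mul1r.
exists z => s se; have Ey := reprK (s *: w); set y := repr _ in Ey.
have : (s - y * r0) *: v = 0.
  apply: annv; apply: all_e => [i|]; rewrite scalerBl -scalerA ?r0e ?r0w.
    by rewrite se scaler0 subrr.
  by rewrite scale_pi1 Ey subrr.
rewrite scalerBl -scalerA Ez => /eqP; rewrite subr_eq0 => /eqP ->.
by rewrite -nucr_act_scale -Ey nucr_actE // scale_pi.
Qed.

(** By density, a vector independent of the previous ones is not killed by the
    generator g of their annihilator; the new generator is then q g, where q, of
    degree deg f, generates the annihilator of the image of the vector under g. *)
Lemma family_annihilator j (e : 'I_j -> V) : exists g : R,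
  [/\ g != 0, (size g <= (j * skew_deg f).+1)%N,
      forall r : R, (forall i, r *: e i = 0) <-> r \in lideal g
    & @independent B V act j e -> size g = (j * skew_deg f).+1].
Proof.
have actP := nucr_module_action.
have sf : size f = (skew_deg f).+1.
  by rewrite /skew_deg prednK // (ltn_trans _ (monic_skew_size f)).
elim: j e => [|j IH] e.
  exists 1; rewrite oner_neq0 size_poly1; split=> // r.
  by split=> [_|_ []//]; apply/lidealP; exists r; rewrite mulr1.
pose e' := e \o lift ord_max.
have [g [g0 le gP gind]] := IH e'.
have all_e (r : R) : (forall i, r *: e i = 0) <->
    r \in lideal g /\ r *: e ord_max = 0.
  split=> [re|[/gP re rm] i]; first by split=> //; apply/gP => i; apply: re.
  case: (unliftP ord_max i) => [k|] -> //.
  exact: re.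
have [w0|w0] := eqVneq (g *: e ord_max) 0.
  exists g; split=> //.
  - by apply: leq_trans le _; rewrite ltnS leq_mul2r leqnSn orbT.
  - move=> r; rewrite all_e; split=> [[]//|rg]; split=> //.
    by case/lidealP: rg => q ->; rewrite -scalerA w0 scaler0.
  - move=> ind; have [|c Ec] := @density j e' (e ord_max).
      by move=> r /gP/lidealP[q ->]; rewrite -scalerA w0 scaler0.
    suff /ind/(_ ord_max)/eqP : lincomb act (rcons_fun c (-1 : B)) e = 0.
      by rewrite /rcons_fun unlift_none oppr_eq0 oner_eq0.
    have [act1 _ _ _] := actP.
    by rewrite lincomb_rcons [act _ _](actNl actP) [act _ _]act1 -Ec subrr.
have [q [q0 sq qP]] := annihilator_generator w0.
have sz : size (q * g : R) = (size g + skew_deg f)%N.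
  by rewrite skew_size_mul // sq sf; lia.
exists (q * g); split.
- exact: skew_mulf_neq0.
- by rewrite sz mulSn addnC -addnS leq_add2l.
- move=> r; rewrite all_e; split=> [[/lidealP[s ->]]|/lidealP[s ->]].
    by rewrite -scalerA => /qP/lidealP[t ->]; rewrite -mulrA; apply/lidealP; exists t.
  split; first by apply/lidealP; exists (s * q); rewrite mulrA.
  rewrite mulrA -scalerA; apply/qP; by apply/lidealP; exists s.
- move=> ind; rewrite sz gind; first by rewrite mulSn addnC addnS.
  move=> c c0 i; suff /ind/(_ (lift ord_max i)) :
      lincomb act (rcons_fun c (0 : B)) e = 0 by rewrite /rcons_fun liftK.
  by rewrite lincomb_rcons [act _ _](act0l actP) addr0.
Qed.

End SimpleModule.

(** * Irreducible factors and annihilators *)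

Section IrreducibleFactors.
Variables (D : nzRingType) (divD : division_ring D) (sigma : {rmorphism D -> D}).
Variables (f : monic_skewpoly sigma) (f_deg : (1 < skew_deg f)%N).
Hypothesis f_irr : nc_irreducible (f : skewpoly sigma).
Local Notation R := (skewpoly sigma).
Local Notation V := (lquot (f : R)).

(** If the quotient of R by the annihilator of finitely many vectors of V maps
    onto R / Rpy, then its subquotient Ry / Rpy, which is R / Rp, is isomorphic
    to V; the vector w is the image of y.  Take z congruent to y modulo Rpy
    that kills as many of the vectors as possible; w is then z applied to the
    next vector. *)
Lemma irreducible_factor_annihilator j (e : 'I_j -> V) (p y : R) :
  nc_irreducible p -> y != 0 ->
  (forall r : R, (forall i, r *: e i = 0) -> r \in lideal (p * y)) ->
  exists2 w : V, w != 0 & forall r : R, r *: w = 0 <-> r \in lideal p.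
Proof.
move=> p_irr y0 annI; have p1 := irreducible_size_gt1 divD p_irr.
have yI : y \notin lideal (p * y).
  apply/lidealP => -[s Es].
  have /(skew_mulf_eq0 divD)[/eqP|y_0] : (1 - s * p) * y = 0.
  - by rewrite mulrBl mul1r -mulrA -Es subrr.
  - rewrite subr_eq0 eq_sym => /eqP sp.
    have s0 : s != 0 by apply: contraNneq (oner_neq0 R) => s0; rewrite -sp s0 mul0r.
    have p0 : p != 0 by rewrite -skew_size_gt0 (ltn_trans _ p1).
    have := skew_size_mul divD s0 p0; rewrite sp size_poly1.
    by move: s0 p1; rewrite -skew_size_gt0; move: (size s) (size p) => a b; clear; lia.
  - by rewrite y_0 eqxx in y0.
pose Q t := exists2 z : R, z - y \in lideal (p * y)
  & forall i : 'I_j, (i < t)%N -> z *: e i = 0.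
have nQj : exists t, ~~ `[< Q t >].
  exists j; apply/asboolP => -[z zy ze]; case/negP: yI.
  have /annI zI : forall i, z *: e i = 0 by move=> i; apply: ze.
  by have := rpredB zI zy; rewrite subKr.
case: (ex_minnP nQj) => -[|t] /asboolP nQ minQ.
  by case: nQ; exists y => //; rewrite subrr; apply: rpred0.
have [z zy ze] : Q t.
  by apply: contrapT => /asboolPn/minQ; rewrite ltnn.
have lt_tj : (t < j)%N.
  rewrite ltnNge; apply/negP => le_jt; apply: nQ; exists z => // i _.
  by apply: ze; apply: leq_trans (ltn_ord i) le_jt.
pose w := z *: e (Ordinal lt_tj).
have next z' : z' - y \in lideal (p * y) ->
    (forall i : 'I_j, (i < t)%N -> z' *: e i = 0) -> z' *: e (Ordinal lt_tj) != 0.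
  move=> z'y z'e; apply/eqP => z'0; apply: nQ; exists z' => // i.
  rewrite ltnS leq_eqVlt => /orP[/eqP it|/z'e//].
  by rewrite -z'0; congr (_ *: e _); apply: val_inj.
have w0 : w != 0 by apply: next.
have pw : p *: w = 0.
  apply/eqP; apply: contraTT isT => pw.
  have [r Er] := simple_cyclic divD f_irr w pw.
  have z'I : z - r * p * z - y \in lideal (p * y).
    rewrite addrAC rpredB // -mulrA lideal_mull // -[z](subrK y) mulrDr.
    rewrite rpredD // ?[_ * (z - y) \in _]lideal_mull //.
    by apply/lidealP; exists 1; rewrite mul1r.
  have := next _ z'I; rewrite scalerBl -!scalerA -/w Er subrr eqxx; apply.
  by move=> i it; rewrite scalerBl -scalerA ze // scaler0 subrr.
exists w => // r; split=> [rw|/lidealP[q ->]]; last by rewrite -scalerA pw scaler0.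
apply: contraTT isT => /(irreducible_bezout divD p_irr)[s [t' E]].
by case/eqP: w0; rewrite -[w]scale1r -E scalerDl -!scalerA rw pw !scaler0 addr0.
Qed.

Lemma lideal_size_eq (p q : R) : p != 0 ->
  p \in lideal q -> q \in lideal p -> size p = size q.
Proof.
move=> p0 /lidealP[a Ea] /lidealP[b Eb].
have a0 : a != 0 by apply: contraNneq p0 => a0; rewrite Ea a0 mul0r.
have q0 : q != 0 by apply: contraNneq p0 => q0; rewrite Ea q0 mulr0.
have b0 : b != 0 by apply: contraNneq q0 => b0; rewrite Eb b0 mul0r.
have := skew_size_mul divD a0 q0; have := skew_size_mul divD b0 p0.
rewrite -Ea -Eb; move: a0 b0; rewrite -!skew_size_gt0.
by move: (size a) (size b) (size p) (size q) => a1 b1 p1 q1; clear; lia.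
Qed.

(** Two generators of the annihilator of w have the same degree. *)
Lemma annihilator_size (w : V) (p : R) : w != 0 ->
  (forall r : R, r *: w = 0 <-> r \in lideal p) -> size p = size f.
Proof.
move=> w0 annw; have [q [q0 <- annq]] := annihilator_generator divD f_irr w0.
have mem x : x \in lideal (x : R) by apply/lidealP; exists 1; rewrite mul1r.
by symmetry; apply: lideal_size_eq => //; [apply/annw/annq | apply/annq/annw].
Qed.

(** The isomorphism sends the class of r to r w. *)
Lemma annihilator_similar (w : V) (p : R) : w != 0 ->
  (forall r : R, r *: w = 0 <-> r \in lideal p) -> nc_similar p (f : R).
Proof.
move=> w0 annw; pose phi (v : lquot p) : V := repr v *: w.
have phiE a : phi (\pi a) = a *: w.
  apply/eqP; rewrite -subr_eq0 -scalerBl; apply/eqP/annw.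
  by rewrite -lquot_eqE reprK.
have phi_lin : linear phi.
  move=> a x y; rewrite -[x]reprK -[y]reprK scale_pi -raddfD !phiE.
  by rewrite scalerDl scalerA.
pose Phi : {linear lquot p -> V} :=
  HB.pack phi (GRing.isLinear.Build _ _ _ _ phi phi_lin).
exists Phi.
have /choice[g gK] v : exists x, phi x = v.
  have [r Er] := simple_cyclic divD f_irr v w0.
  by exists (\pi r); rewrite phiE.
exists g => //= x; have := gK (phi x); rewrite -{2}[x]reprK -{1}[g _]reprK !phiE.
move/eqP; rewrite -subr_eq0 -scalerBl => /eqP/annw.
by rewrite -lquot_eqE !reprK => /eqP.
Qed.

End IrreducibleFactors.

(** * The annihilator of R / Rf is generated by a central polynomial *)

Section Generators.
Variables (D : nzRingType) (sigma : {rmorphism D -> D}).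
Local Notation R := (skewpoly sigma).
Local Notation t := (skewX sigma).
Implicit Types p z : R.

Lemma skew_coefXn i j : (t ^+ i)`_j = (j == i)%:R.
Proof.
rewrite -[t ^+ i]mulr1 skew_coefXnM; case: ltnP => [lt_ji|le_ij].
  by rewrite (ltn_eqF lt_ji).
rewrite coef1; have [->|ne] := eqVneq j i; first by rewrite subnn iters1.
by rewrite subn_eq0 leqNgt ltn_neqAle eq_sym ne le_ij iters0.
Qed.

Lemma skew_size_Xn i : size (t ^+ i) = i.+1.
Proof.
rewrite -[RHS](size_polyXn D); congr (size (polyseq _)).
by apply/polyP => j; rewrite skew_coefXn coefXn.
Qed.

Lemma skew_expand p N : (size p <= N)%N ->
  p = \sum_(i < N) skewC sigma p`_i * t ^+ i.
Proof.
move=> le_pN; apply: skewP => j.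
rewrite (raddf_sum (@skew_coefs D sigma)) coef_sum.
under eq_bigr => i _ do rewrite skew_coefCM skew_coefXn.
have [lt_jN|le_Nj] := ltnP j N.
  rewrite (bigD1 (Ordinal lt_jN)) //= eqxx mulr1 big1 ?addr0 // => i ne.
  by rewrite [j == i]eq_sym -[_ == j]/(i == Ordinal lt_jN) (negPf ne) mulr0.
rewrite nth_default ?(leq_trans le_pN) // big1 // => i _.
by rewrite gtn_eqF ?mulr0 // (leq_trans _ le_Nj).
Qed.

Lemma central_of_generators z : (forall a, z * skewC sigma a = skewC sigma a * z) ->
  z * t = t * z -> nc_central z.
Proof.
move=> zC zt y; have zX i : z * t ^+ i = t ^+ i * z.
  elim: i => [|i IH]; first by rewrite mulr1 mul1r.
  by rewrite exprS mulrA zt -mulrA IH mulrA.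
rewrite (skew_expand (leqnn (size y))) mulr_sumr mulr_suml; apply: eq_bigr => i _.
by rewrite mulrA zC -mulrA zX mulrA.
Qed.

Lemma skewXn_comm i a : t ^+ i * skewC sigma a = skewC sigma (iter i sigma a) * t ^+ i.
Proof.
elim: i => [|i IH]; first by rewrite mulr1 mul1r.
by rewrite [in LHS]exprS -mulrA IH mulrA skewX_comm -mulrA -exprS.
Qed.

(** Since sigma is onto, t R = R t; the coefficients of p' are preimages of those
    of p. *)
Lemma skewX_conj (sigma_bij : bijective sigma) p : exists p', p * t = t * p'.
Proof.
have [tau _ tauK] := sigma_bij.
exists (SkewPoly sigma (\poly_(i < size p) tau p`_i)); apply: skewP => -[|i].
  by rewrite skew_coefMX skew_coefXM.
rewrite skew_coefMX skew_coefXM coef_poly; case: ltnP => [_|le]; rewrite ?tauK //.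
by rewrite rmorph0 nth_default.
Qed.

End Generators.

Section CentralMultiple.
Variables (C : fieldType) (D : falgType C).
Hypothesis D_division : forall x : D, x != 0 -> x \is a GRing.unit.
Variables (sigma : {rmorphism D -> D}) (sigma_bij : bijective sigma).
Variables (n : nat) (u : D).
Hypotheses (n_gt0 : (0 < n)%N) (u_unit : u \is a GRing.unit) (sigma_u : sigma u = u).
Hypothesis sigma_n : forall z, iter n sigma z = u * z * u^-1.
Local Notation R := (skewpoly sigma).
Local Notation t := (skewX sigma).

Lemma unit_division_ring : division_ring D.
Proof. by move=> a /D_division ua; exists a^-1; rewrite mulVr. Qed.
Local Notation divD := unit_division_ring.

Lemma iter_sigma_mul q z : iter (q * n) sigma z = u ^+ q * z * u ^- q.
Proof.
elim: q => [|q IH]; first by rewrite mul0n expr0 invr1 mul1r mulr1.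
rewrite mulSn iterD IH sigma_n [u ^+ q.+1]exprS invrM ?unitrX //.
by rewrite !mulrA.
Qed.

Lemma sigma_uX q : sigma (u ^- q) = u ^- q.
Proof. by rewrite rmorphV ?unitrX // rmorphXn /= sigma_u. Qed.

(** Division of M by n: a nonzero remainder would contradict the minimality of n,
    because sigma^n is inner. *)
Lemma iter_sigma_inner M : (forall j : nat, (0 < j < n)%N -> ~ inner (iter j sigma)) ->
  inner (iter M sigma) -> (n %| M)%N.
Proof.
move=> n_min [v v_unit Ev]; apply/dvdnP; exists (M %/ n)%N.
rewrite {1}(divn_eq M n); set q := (M %/ n)%N; case: (posnP (M %% n)) => [->|r0].
  by rewrite addn0.
case: (n_min (M %% n)%N); first by rewrite r0 ltn_pmod.
exists (v * u ^- q); first by rewrite unitrMl // unitrV unitrX.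
move=> z; have := Ev (u ^- q * z * u ^+ q).
rewrite {1}(divn_eq M n) addnC iterD iter_sigma_mul -/q !mulrA divrr ?unitrX // mul1r.
rewrite -mulrA divrr ?unitrX // mulr1 => ->.
by rewrite invrM ?unitrV ?unitrX // invrK !mulrA.
Qed.

Variables (f : monic_skewpoly sigma) (f_deg : (1 < skew_deg f)%N).
Hypothesis f_irr : nc_irreducible (f : R).
Hypothesis n_min : forall j : nat, (0 < j < n)%N -> ~ inner (iter j sigma).
Local Notation V := (lquot (f : R)).

(** t V is a submodule, as R t = t R, and it is not 0: t is not a multiple of f,
    which has degree greater than 1. *)
Lemma skewX_onto (v : V) : exists w : V, v = t *: w.
Proof.
have t0 : t *: (\pi 1 : V) != 0.
  rewrite scale_pi1 pi_eq0 -skew_rem_eq0 skew_rem_id.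
    by rewrite -skew_size_eq0 size_polyX.
  by rewrite size_polyX; move: f_deg; rewrite /skew_deg; case: (size f) => [|[]].
have [r <-] := simple_cyclic divD f_irr v t0.
have [r' E] := skewX_conj sigma_bij r.
by exists (r' *: (\pi 1 : V)); rewrite !scalerA E.
Qed.

(** The annihilator of V is generated by a central polynomial.  Its monic
    generator g commutes with t and satisfies g a = sigma^M(a) g for M = deg g;
    comparing the constant terms shows that sigma^M is inner, so that n divides
    M, and u ^- (M / n) g is central.  The constant term is not 0 because t acts
    on V surjectively. *)
Lemma annihilator_central N (e : 'I_N -> V) : right_basis e ->
  exists g : R, [/\ nc_central g, size g = (N * skew_deg f).+1
    & forall r : R, (forall v : V, r *: v = 0) <-> r \in lideal g].
Proof.
move=> [spe inde]; have [g [g0 _ ge /(_ inde) sg]] :=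
  family_annihilator divD f_deg f_irr e.
have annV (r : R) : (forall v : V, r *: v = 0) <-> r \in lideal g.
  split=> [rV|/ge re v]; first by apply/ge => i; apply: rV.
  have [c ->] := (spe v).1 I; rewrite /lincomb scaler_sumr big1 // => i _.
  by rewrite -nucr_act_scale // re [LHS](act0r (nucr_module_action f_deg)).
have [c [c0 mg sz]] := skew_make_monic divD g0.
set g' := skewC sigma c * g in mg sz *; set M := (N * skew_deg f)%N in sg *.
have {ge} annV' (r : R) : (forall v : V, r *: v = 0) <-> r \in lideal g'.
  have [b [bc cb]] := division_inv divD c0.
  rewrite annV; split=> /lidealP[q ->]; apply/lidealP.
    exists (q * skewC sigma b).
    by rewrite -mulrA /g' [skewC sigma b * (_ * _)]mulrA -rmorphM bc mul1r.
  by exists (q * skewC sigma c); rewrite -mulrA.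
clearbody g'; have g'0 : g' != 0 by rewrite -skew_size_eq0 sz sg.
have gM : g'`_M = 1 by move/eqP: mg; rewrite lead_coefE sz sg.
have g'V (v : V) : g' *: v = 0.
  by move: v; apply/annV'; apply/lidealP; exists 1; rewrite mul1r.
(* The annihilator of a module is a two-sided ideal. *)
have two_sided x : exists2 s : R, g' * x = s * g' & (x != 0 -> size s = size x).
  have /annV'/lidealP[s Es] : forall v : V, (g' * x) *: v = 0.
    by move=> v; rewrite -scalerA g'V.
  exists s => // x0; have := skew_size_mul divD g'0 x0; rewrite Es.
  have s0 : s != 0.
    by apply: contraNneq (skew_mulf_neq0 divD g'0 x0) => s0; rewrite Es s0 mul0r.
  rewrite (skew_size_mul divD) //; move: s0 x0 g'0; rewrite -!skew_size_gt0.
  by move: (size s) (size x) (size g') => i j k; clear; lia.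
(* Otherwise g' = g1 t with g1 V = g1 t V = 0, and g1 has smaller degree. *)
have c0n : g'`_0 != 0.
  apply/eqP => g00; pose g1 : R := SkewPoly sigma (\poly_(i < M) g'`_i.+1).
  have Eg : g' = g1 * t.
    apply: skewP => -[|i]; rewrite skew_coefMX // coef_poly; case: ltnP => // le.
    by rewrite nth_default // sz sg.
  have : g1 \in lideal g'.
    apply/annV' => v; have [w ->] := skewX_onto v.
    by rewrite scalerA -Eg g'V.
  case/lidealP=> s Es; have [s0|s0] := eqVneq s 0.
    by move: g'0; rewrite Eg Es s0 !mul0r eqxx.
  have : (size g1 <= M)%N by apply: size_poly.
  rewrite leqNgt Es (skew_size_mul divD) // sz sg.
  by move: s0; rewrite -skew_size_gt0; move: (size s) => a; clear; lia.
have gC a : g' * skewC sigma a = skewC sigma (iter M sigma a) * g'.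
  have [->|a0] := eqVneq a 0; first by rewrite iters0 raddf0 mulr0 mul0r.
  have [s Es ss] := two_sided (skewC sigma a).
  have /skew_size1P[s0 s00 Es0] : size s = 1%N.
    by rewrite ss ?size_polyC ?a0 // -skew_size_eq0 size_polyC a0.
  rewrite Es Es0; congr (skewC sigma _ * _).
  have /(congr1 (fun p : R => p`_M)) := Es.
  by rewrite Es0 skew_coefMC skew_coefCM gM mul1r mulr1 => <-.
have gt : g' * t = t * g'.
  have [s Es ss] := two_sided t.
  have s2 : size s = 2%N by rewrite ss ?size_polyX // -skew_size_eq0 size_polyX.
  rewrite Es; congr (_ * _); apply: skewP.
  have /(congr1 (fun p : R => p`_0)) := Es.
  rewrite skew_coefMX skew_coefM big_ord_recl big_ord0 addr0 /= => s0.
  have /(division_mulf_eq0 divD)[s0_|g00] : s`_0 * g'`_0 = 0 by rewrite -s0.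
    2: by rewrite g00 eqxx in c0n.
  have /(congr1 (fun p : R => p`_M.+1)) := Es.
  rewrite skew_coefMX gM -add1n skew_coef_mul_top ?s2 ?sz ?sg // gM iters1 mulr1.
  move=> s1 [|[|i]]; rewrite coefX ?s0_ //= nth_default //.
  by rewrite s2.
have nM : (n %| M)%N.
  apply: iter_sigma_inner n_min _; exists g'`_0; first exact: D_division.
  move=> z; have /(congr1 (fun p : R => p`_0)) := gC z.
  by rewrite skew_coefMC skew_coefCM /= => ->; rewrite mulrK ?D_division.
pose q := (M %/ n)%N; have Mq : M = (q * n)%N by rewrite divnK.
have uq : u ^- q \is a GRing.unit by rewrite unitrV unitrX.
have uq1 : u ^- q != 0 by apply: contraTneq uq => ->; rewrite unitr0.
have uq0 : skewC sigma (u ^- q) != 0 by rewrite -skew_size_eq0 size_polyC uq1.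
exists (skewC sigma (u ^- q) * g'); split.
- apply: central_of_generators => [a|].
    rewrite -mulrA gC !mulrA -!rmorphM Mq iter_sigma_mul.
    by rewrite !mulrA mulVr ?unitrX // mul1r.
  by rewrite -mulrA gt !mulrA skewX_comm sigma_uX.
- by rewrite (skew_size_mul divD) // sz sg size_polyC uq1.
- move=> r; rewrite annV'; split=> /lidealP[s ->]; apply/lidealP.
    exists (s * skewC sigma (u ^+ q)).
    rewrite -mulrA [skewC sigma (u ^+ q) * (_ * _)]mulrA -rmorphM.
    by rewrite divrr ?unitrX // mul1r.
  by exists (s * skewC sigma (u ^- q)); rewrite -mulrA.
Qed.

End CentralMultiple.

(** * The minimal central left multiple and the dimension of R / Rf *)

Section CentralEvaluation.
Variables (C : fieldType) (D : falgType C).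
Hypothesis D_division : forall x : D, x != 0 -> x \is a GRing.unit.
Variables (sigma : {rmorphism D -> D}) (n : nat) (u : D).
Hypotheses (n_gt0 : (0 < n)%N) (u_unit : u \is a GRing.unit) (sigma_u : sigma u = u).
Hypothesis sigma_n : forall z, iter n sigma z = u * z * u^-1.
Local Notation R := (skewpoly sigma).
Local Notation t := (skewX sigma).
Local Notation F := (fixF sigma).
Local Notation divD := (unit_division_ring D_division).

Definition central_var : R := skewC sigma u^-1 * t ^+ n.

Lemma fixF_in_comm (c : F) (a : D) : fixF_in sigma c * a = a * fixF_in sigma c.
Proof. by rewrite /= -scalerAl -scalerAr mul1r mulr1. Qed.

Lemma sigma_fixF_in (c : F) : sigma (fixF_in sigma c) = fixF_in sigma c.
Proof. by apply/eqP; apply: (valP c). Qed.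

Lemma fixF_central (c : F) : nc_central (skewC sigma (fixF_in sigma c)).
Proof.
apply: central_of_generators => [a|]; last by rewrite skewX_comm sigma_fixF_in.
by rewrite -!rmorphM fixF_in_comm.
Qed.

Lemma central_var_central : nc_central central_var.
Proof.
apply: central_of_generators => [a|].
  rewrite -mulrA skewXn_comm !mulrA -!rmorphM sigma_n.
  by rewrite !mulrA mulVr // mul1r.
rewrite /central_var -mulrA -exprSr exprS !mulrA skewX_comm; congr (skewC _ _ * _ * _).
by rewrite rmorphV // sigma_u.
Qed.

Fact central_var_comm : commr_rmorph (skewC sigma \o fixF_in sigma) central_var.
Proof. by move=> c; symmetry; apply: fixF_central. Qed.

Local Notation ceval := (@central_eval C D sigma u n).

Lemma central_evalM p q : ceval (p * q) = ceval p * ceval q.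
Proof. exact: (rmorphM (horner_morph central_var_comm)). Qed.

Lemma central_evalB p q : ceval (p - q) = ceval p - ceval q.
Proof. exact: (rmorphB (horner_morph central_var_comm)). Qed.

Lemma central_evalD p q : ceval (p + q) = ceval p + ceval q.
Proof. exact: (rmorphD (horner_morph central_var_comm)). Qed.

Lemma central_evalC c : ceval c%:P = skewC sigma (fixF_in sigma c).
Proof. exact: (horner_morphC central_var_comm). Qed.

Lemma central_evalX : ceval 'X = central_var.
Proof. exact: (horner_morphX central_var_comm). Qed.

Lemma central_eval_central p : nc_central (ceval p).
Proof.
elim/poly_ind: p => [|p c IH] y.
  by rewrite [ceval 0](rmorph0 (horner_morph central_var_comm)) mul0r mulr0.
rewrite central_evalD central_evalM central_evalX central_evalC.
rewrite mulrDl mulrDr; congr (_ + _); last exact: fixF_central.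
by rewrite -mulrA central_var_central mulrA IH -mulrA.
Qed.

Lemma central_var_size : size central_var = n.+1.
Proof.
have uV0 : u^-1 != 0.
  by apply: contraTneq u_unit => e; rewrite -unitrV e unitr0.
rewrite (skew_size_mul divD) -?skew_size_eq0 ?skew_size_Xn //.
  by rewrite size_polyC uV0.
by rewrite size_polyC uV0.
Qed.

(** The variable has degree n, hence the degree is multiplied by n. *)
Lemma central_eval_size p : p != 0 -> size (ceval p) = (n * (size p).-1).+1.
Proof.
elim/poly_ind: p => [|p c IH]; first by rewrite eqxx.
rewrite central_evalD central_evalM central_evalX central_evalC.
have sc : (size (skewC sigma (fixF_in sigma c)) <= 1)%N.
  by rewrite size_polyC leq_b1.
have [->|p0] := eqVneq p 0.
  rewrite mul0r add0r polyC_eq0 => c0.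
  rewrite [ceval 0](rmorph0 (horner_morph central_var_comm)) mul0r add0r.
  by rewrite !size_polyC c0 muln0 fmorph_eq0 c0.
move=> _; have sX : size (p * 'X + c%:P) = (size p).+1.
  by rewrite size_MXaddC (negPf p0).
have v0 : central_var != 0 by rewrite -skew_size_eq0 central_var_size.
have e0 : ceval p != 0 by rewrite -skew_size_eq0 IH.
have sM : size (ceval p * central_var : R) = (n * size p).+1.
  rewrite (skew_size_mul divD) // IH // central_var_size.
  have : (0 < size p)%N by rewrite size_poly_gt0.
  by case: (size p) => // a _; rewrite mulnS /=; clear; lia.
rewrite sX /= -sM; apply: size_polyDl; apply: leq_ltn_trans sc _.
rewrite -[X in (_ < X)%N]/(size (ceval p * central_var : R)%R) sM.
by rewrite ltnS muln_gt0 n_gt0 size_poly_gt0.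
Qed.

End CentralEvaluation.

Section Annihilator.
Variables (C : fieldType) (D : falgType C).
Hypothesis D_division : forall x : D, x != 0 -> x \is a GRing.unit.
Variables (sigma : {rmorphism D -> D}) (sigma_bij : bijective sigma).
Variables (n : nat) (u : D).
Hypotheses (n_gt0 : (0 < n)%N) (u_unit : u \is a GRing.unit) (sigma_u : sigma u = u).
Hypothesis sigma_n : forall z, iter n sigma z = u * z * u^-1.
Hypothesis n_min : forall j : nat, (0 < j < n)%N -> ~ inner (iter j sigma).
Variables (f : monic_skewpoly sigma) (f_deg : (1 < skew_deg f)%N).
Hypothesis f_irr : nc_irreducible (f : skewpoly sigma).
Variable hhat : {poly fixF sigma}.
Hypothesis f_mclm : min_central_left_multiple u n f hhat.
Local Notation R := (skewpoly sigma).
Local Notation V := (lquot (f : R)).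
Local Notation h := (central_eval u n hhat).
Local Notation divD := (unit_division_ring D_division).

Lemma mclm_neq0 : h != 0.
Proof.
have [/monic_neq0 h0 _ _ _] := f_mclm.
by rewrite -skew_size_eq0 (central_eval_size D_division).
Qed.

Lemma mclm_annihilates (v : V) : h *: v = 0.
Proof.
have [_ hC hf _] := f_mclm; rewrite -[v]reprK scale_pi hC.
by apply/eqP; rewrite pi_eq0 lideal_mull.
Qed.

(** h kills V, so it lies in the annihilator of any j independent vectors, whose
    nonzero elements have degree at least j deg f; this bounds j. *)
Lemma lquot_has_basis : exists N (e : 'I_N -> V), right_basis e.
Proof.
have [||N _ [e be]] := @bounded_has_dim _ _ _ (nucr_module_action f_deg)
   (division_ring_conv (nucr_division divD f_deg f_irr)) setT (size h).
- by split.
- move=> r e _ ind; have [g [g0 _ ge /(_ ind) sg]] :=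
    family_annihilator divD f_deg f_irr e.
  have /ge/lidealP[s Es] : forall i, h *: e i = 0 by move=> i; apply: mclm_annihilates.
  have h0 := mclm_neq0.
  have s0 : s != 0 by apply: contraNneq h0 => s0; rewrite Es s0 mul0r.
  rewrite Es (skew_size_mul divD) // sg addnS /=.
  apply: leq_trans (leq_addl _ _).
  by apply: leq_pmulr; apply: ltn_trans f_deg.
by exists N, e.
Qed.

(** The central generator g of the annihilator of V is a left multiple of f, so
    that deg h <= deg g by minimality; as h kills V, it is a multiple of g. *)
Lemma mclm_annihilator N (e : 'I_N -> V) : right_basis e ->
  size h = (N * skew_deg f).+1 /\
  forall r : R, (forall v : V, r *: v = 0) <-> r \in lideal h.
Proof.
move=> be; have [g [gC sg annV]] := annihilator_central D_division sigma_bij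
  n_gt0 u_unit sigma_u sigma_n f_deg f_irr n_min be.
have h0 := mclm_neq0; have g0 : g != 0 by rewrite -skew_size_eq0 sg.
have /annV/lidealP[s Es] := mclm_annihilates.
have [_ _ _ /(_ g gC (elimN eqP g0))] := f_mclm.
have s0 : s != 0 by apply: contraNneq h0 => s0; rewrite Es s0 mul0r.
have mem x : x \in lideal (x : R) by apply/lidealP; exists 1; rewrite mul1r.
have gf : g \in lideal (f : R).
  by rewrite -pi_eq0 -scale_pi1; apply/eqP; move: (\pi 1); apply/annV.
move=> /(_ gf); rewrite /skew_deg [in X in (X <= _)%N]Es => le.
have /(skew_nc_unitP divD)[s' [_ s's]] : size s = 1%N.
  rewrite (skew_size_mul divD s0 g0) in le; move: le s0 g0; rewrite -!skew_size_gt0.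
  by move: (size s) (size g) => a b; clear; lia.
split=> [|r].
  rewrite -sg; apply: (lideal_size_eq divD); first by [].
    by rewrite Es lideal_mull.
  by apply/lidealP; exists s'; rewrite Es mulrA s's mul1r.
rewrite annV; split=> /lidealP[q ->]; last by rewrite Es !lideal_mull.
by apply/lidealP; exists (q * s'); rewrite Es mulrA -[q * s' * s]mulrA s's mulr1.
Qed.

(** All irreducible factors of h have the degree of f because h generates the
    annihilator of V; comparing degrees shows that there are dim_B V of them. *)
Lemma factorization_dim N (e : 'I_N -> V) k : right_basis e ->
  has_irr_factorization h k -> N = k.
Proof.
move=> be [s <- [s_irr Eh]]; have [sh annh] := mclm_annihilator be.
have h0 := mclm_neq0.
have s_size p : p \in s -> size p = size f.
  move=> ps; have [s1 [s2 Es]] : exists s1 s2, s = s1 ++ p :: s2.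
    by case/splitPr: ps => s1 s2; exists s1, s2.
  pose y := \prod_(q <- s2) q; pose a := \prod_(q <- s1) q.
  have Eh' : h = a * (p * y) by rewrite Eh Es big_cat big_cons.
  have y0 : y != 0 by apply: contraNneq h0 => y0; rewrite Eh' y0 !mulr0.
  have [|w w0 annw] := irreducible_factor_annihilator divD f_irr
     (e := e) (s_irr p ps) y0.
    move=> r re; have /annh/lidealP[q ->] : forall v : V, r *: v = 0.
      move=> v; have [c ->] := (be.1 v).1 I.
      rewrite /lincomb scaler_sumr big1 // => i _.
      by rewrite -nucr_act_scale // re [LHS](act0r (nucr_module_action f_deg)).
    by rewrite Eh' mulrA lideal_mull //; apply/lidealP; exists 1; rewrite mul1r.
  exact (annihilator_size divD f_irr w0 annw).
have sf : size f = (skew_deg f).+1.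
  by rewrite /skew_deg prednK // (ltn_trans _ (monic_skew_size f)).
have : size (\prod_(p <- s) p : R) = (size s * skew_deg f).+1 /\
    (\prod_(p <- s) p != 0 :> R).
  elim: s s_size {s_irr Eh} => [|p s IH] s_size.
    by rewrite big_nil size_poly1 oner_neq0.
  rewrite big_cons; have [|sp p0] := IH.
    by move=> q qs; apply: s_size; rewrite inE qs orbT.
  have sp' : size p = size f by apply: s_size; rewrite inE eqxx.
  have pn0 : p != 0 by rewrite -skew_size_eq0 sp' sf.
  split; last exact: (skew_mulf_neq0 divD).
  by rewrite (skew_size_mul divD) // sp sp' sf /= mulSn addnS.
rewrite -Eh sh => -[[/eqP]]; rewrite eqn_pmul2r; first by move/eqP.
exact: ltn_trans f_deg.
Qed.

End Annihilator.

(** * Ranks of left multiplications *)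

Section KernelBound.
Variables (D : nzRingType) (divD : division_ring D) (sigma : {rmorphism D -> D}).
Variables (f : monic_skewpoly sigma) (f_deg : (1 < skew_deg f)%N).
Hypothesis f_irr : nc_irreducible (f : skewpoly sigma).
Local Notation R := (skewpoly sigma).
Local Notation V := (lquot (f : R)).
Local Notation B := (nucr f).
Local Notation act := (@nucr_act D sigma f).

(** The generator of the annihilator of j independent vectors has degree j deg f,
    and a is a multiple of it. If j = l, then a itself generates the annihilator,
    and all irreducible factors of a are similar to f. *)
Lemma kernel_dim_lt (a : R) l j : a != 0 -> (size a <= (l * skew_deg f).+1)%N ->
  (skew_deg a = (l * skew_deg f)%N ->
     ~ (forall p : R, irr_factor p a -> nc_similar p (f : R))) ->
  @has_dim B V act [set v | a *: v = 0]%classic j -> (j < l)%N.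
Proof.
move=> a0 size_a avoid [x [kera indx]].
have xa i : a *: x i = 0.
  by apply/kera; apply: (@span_mem B^c V act (nucr_module_action f_deg)).
have [g [g0 _ gx /(_ indx) sg]] := family_annihilator divD f_deg f_irr x.
have /gx/lidealP[s Es] := xa.
have s0 : s != 0 by apply: contraNneq a0 => s0; rewrite Es s0 mul0r.
have sa : size a = (size s + j * skew_deg f)%N.
  by rewrite Es (skew_size_mul divD) // sg addnS.
have m0 : (0 < skew_deg f)%N by apply: ltn_trans f_deg.
have le_jl : (j <= l)%N.
  rewrite -(leq_pmul2r m0) -ltnS (leq_trans _ size_a) // sa.
  by rewrite -add1n leq_add2r skew_size_gt0.
rewrite ltn_neqAle le_jl andbT; apply/eqP => ejl; rewrite -ejl in avoid size_a.
have /(skew_nc_unitP divD)[s' [_ s's]] : size s = 1%N.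
  apply/eqP; rewrite eqn_leq skew_size_gt0 s0 andbT.
  by move: size_a; rewrite sa -add1n leq_add2r.
case: avoid.
  rewrite /skew_deg sa; move: size_a s0; rewrite sa -skew_size_gt0.
  by move: (size s) (_ * _)%N => b c; clear; lia.
move=> p [p_irr [b [y Ea]]].
have y0 : y != 0 by apply: contraNneq a0 => y0; rewrite Ea y0 mulr0.
have [r /gx/lidealP[q ->]|w w0 annw] :=
    irreducible_factor_annihilator divD f_irr (e := x) p_irr y0.
  apply/lidealP; exists (q * s' * b).
  by rewrite -[RHS]mulrA [b * _]mulrA -Ea Es -mulrA [s' * _]mulrA s's mul1r.
exact (annihilator_similar divD f_irr w0 annw).
Qed.

End KernelBound.

Section Code.
Variables (C : fieldType) (D : falgType C).
Hypothesis D_division : forall x : D, x != 0 -> x \is a GRing.unit.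
Variable sigma : {rmorphism D -> D}.
Variables (f : monic_skewpoly sigma) (f_deg : (1 < skew_deg f)%N).
Hypothesis f_irr : nc_irreducible (f : skewpoly sigma).
Local Notation R := (skewpoly sigma).
Local Notation V := (lquot (f : R)).
Local Notation B := (nucr f).
Local Notation act := (@nucr_act D sigma f).
Local Notation divD := (unit_division_ring D_division).
Variables (k : nat) (e : 'I_k -> V).
Hypothesis be : right_basis e.

Let actP : @module_action B^c V act := nucr_module_action f_deg.
Let divB := division_ring_conv (nucr_division divD f_deg f_irr).

Lemma coord_inj (c c' : 'I_k -> B) : lincomb act c e = lincomb act c' e -> c =1 c'.
Proof.
move=> E i; apply/eqP; rewrite -subr_eq0; apply/eqP.
apply: (be.2 (fun i => c i - c' i)); apply/eqP; rewrite -(subrr (lincomb act c' e)).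
rewrite -[X in _ == X - _]E /lincomb -sumrB; apply/eqP; apply: eq_bigr => j _.
have [_ _ actD _] := actP; rewrite [LHS]actD; congr (_ + _).
exact: (actNl actP).
Qed.

Definition mul_matrix (a : R) (M : 'M[B]_k) :=
  forall j, a *: e j = \sum_i act (M i j) (e i).

Lemma mul_matrix_exists a : exists M, mul_matrix a M.
Proof.
have /fin_all_exists[c Ec] j : exists c, a *: e j = lincomb act c e by apply/be.1.
by exists (\matrix_(i, j) c j i) => j; rewrite Ec; apply: eq_bigr => i _; rewrite mxE.
Qed.

Lemma mul_matrix_unique a M M' : mul_matrix a M -> mul_matrix a M' -> M = M'.
Proof.
move=> Ma M'a; apply/matrixP => i j.
by apply: (@coord_inj (M^~ j) (M'^~ j)); rewrite /lincomb -Ma -M'a.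
Qed.

Lemma mul_matrixB a b M M' : mul_matrix a M -> mul_matrix b M' ->
  mul_matrix (a - b) (M - M').
Proof.
move=> Ma Mb j; rewrite scalerBl Ma Mb -sumrB; apply: eq_bigr => i _.
have [_ _ actD _] := actP; rewrite !mxE [RHS]actD; congr (_ + _).
by rewrite [RHS](actNl actP).
Qed.

Lemma scale_lincomb a (c : 'I_k -> B) :
  a *: lincomb act c e = lincomb act c (fun j => a *: e j).
Proof.
by rewrite /lincomb scaler_sumr; apply: eq_bigr => j _; rewrite nucr_act_scale.
Qed.

Definition from_coords (x : 'cV[B]_k) : V := lincomb act (fun i => x i 0) e.

Lemma from_coordsB : zmod_morphism from_coords.
Proof.
move=> x y; rewrite /from_coords /lincomb -sumrB; apply: eq_bigr => i _.
have [_ _ actD _] := actP; rewrite !mxE [LHS]actD; congr (_ + _).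
exact: (actNl actP).
Qed.

Lemma from_coords_inj : injective from_coords.
Proof. by move=> x y /coord_inj E; apply/colP. Qed.

Lemma from_coords_scale b x : from_coords (col_rscale b x) = act b (from_coords x).
Proof.
rewrite /from_coords -[RHS](lincombZ actP); apply: eq_bigr => i _.
by rewrite mxE.
Qed.

(** This makes the column rank of M the dimension of the range of L_a, which is
    computed in V by rank-nullity. *)
Lemma from_coords_colspace a M : mul_matrix a M ->
  (from_coords @` colspace M = range (fun v : V => a *: v))%classic.
Proof.
move=> Ma; have from0 : from_coords 0 = 0 by rewrite -(subrr 0) from_coordsB subrr.
have fromD : {morph from_coords : x y / x + y}.
  move=> x y; rewrite -{1}[y]opprK -[- y]sub0r !from_coordsB from0 sub0r.
  by rewrite opprK.
have E c : from_coords (lincomb (@col_rscale B k) c (fun j => col j M)) =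
    a *: lincomb act c e.
  rewrite scale_lincomb /lincomb (big_morph from_coords fromD from0).
  apply: eq_bigr => j _; rewrite from_coords_scale Ma; congr (act _ _).
  by apply: eq_bigr => i _; rewrite mxE.
apply/seteqP; split=> [_ [_ [c ->] <-]|_ [v _ <-]].
  by exists (lincomb act c e) => //; rewrite E.
by have [c ->] := (be.1 v).1 I; rewrite -E; eexists; first by exists c.
Qed.

Lemma has_rank_dist_range a b M M' r : mul_matrix a M -> mul_matrix b M' ->
  has_rank_dist M M' r <-> has_dim act (range (fun v : V => (a - b) *: v)) r.
Proof.
move=> Ma Mb; rewrite -(from_coords_colspace (mul_matrixB Ma Mb)).
have bij_id : bijective (@id B) by exists id.
symmetry; exact: (@has_dim_image B^c B^c _ _ _ _ id from_coords _ r actP bij_id erefl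
  from_coordsB from_coords_inj from_coords_scale).
Qed.

Lemma rank_kernel a j r :
  has_dim act [set v : V | a *: v = 0]%classic j ->
  has_dim act (range (fun v : V => a *: v)) r -> k = (j + r)%N.
Proof.
apply: (@rank_nullity B^c V act actP divB (fun v : V => a *: v) k).
- by move=> x y; rewrite scalerDr.
- by move=> b v; rewrite nucr_act_scale.
- by exists e.
Qed.

Lemma kernel_has_dim a : exists j, has_dim act [set v : V | a *: v = 0]%classic j.
Proof.
apply: (@subspace_has_dim B^c V act actP divB _ setT k) => //; last by exists e.
split=> /= [|b v w av aw]; first by rewrite scaler0.
by rewrite scalerDr aw addr0 -nucr_act_scale // av [LHS](act0r actP).
Qed.

Lemma range_has_dim a : exists r, has_dim act (range (fun v : V => a *: v)) r.
Proof.
apply: (@subspace_has_dim B^c V act actP divB _ setT k) => //; last by exists e.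
split=> [|b _ _ [v _ <-] [w _ <-]]; first by exists 0; rewrite ?scaler0.
by exists (act b v + w); rewrite // scalerDr nucr_act_scale.
Qed.

Variables (P : set R) (l : nat).
Hypotheses (l_gt0 : (0 < l)%N) (l_lt_k : (l < k)%N).
Hypothesis P0 : P 0.
Hypothesis PB : forall a b, P a -> P b -> P (a - b).
Hypothesis P_size : forall a, P a -> (size a <= (l * skew_deg f).+1)%N.
Hypothesis P_avoids : forall a, P a -> skew_deg a = (l * skew_deg f)%N ->
  ~ (forall p : R, irr_factor p a -> nc_similar p (f : R)).
Hypothesis P_low : forall a : R, (size a <= l * skew_deg f)%N -> a`_0 = 0 -> P a.

Lemma code_kernel_lt a j : P a -> a != 0 ->
  has_dim act [set v : V | a *: v = 0]%classic j -> (j < l)%N.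
Proof.
move=> Pa a0; apply: (kernel_dim_lt divD f_deg f_irr a0); first exact: P_size.
exact: P_avoids.
Qed.

Lemma code_rank_geq a r : P a -> a != 0 ->
  has_dim act (range (fun v : V => a *: v)) r -> (k - l + 1 <= r)%N.
Proof.
move=> Pa a0 dr; have [j dj] := kernel_has_dim a.
move: l_lt_k (code_kernel_lt Pa a0 dj); rewrite (rank_kernel dj dr).
by clear; lia.
Qed.

(** The witness is s t, where s, of degree at most (l - 1) deg f, kills the vectors
    t e_0, ..., t e_(l - 2). It has no constant term, and its degree is less than
    l deg f because deg f > 1. *)
Lemma code_low_rank : exists a, [/\ P a, a != 0
  & forall i : 'I_k, (i < l.-1)%N -> a *: e i = 0].
Proof.
have le : (l.-1 <= k)%N by apply: leq_trans (leq_pred l) (ltnW l_lt_k).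
have [g [g0 sg ge _]] := family_annihilator divD f_deg f_irr
  (fun i : 'I_l.-1 => skewX sigma *: e (widen_ord le i)).
have t0 : skewX sigma != 0 by rewrite -skew_size_eq0 size_polyX.
exists (g * skewX sigma); split.
- apply: P_low; last by rewrite skew_coefMX.
  rewrite (skew_size_mul divD) // size_polyX addn2 /=.
  apply: (@leq_ltn_trans (l.-1 * skew_deg f).+1) => //.
  by rewrite -[in X in (_ < X)%N](prednK l_gt0) mulSn -addn2 addnC leq_add2r.
- exact: (skew_mulf_neq0 divD).
- move=> i lt_i; rewrite -scalerA.
  have /ge/(_ (Ordinal lt_i)) : g \in lideal (g : R).
    by apply/lidealP; exists 1; rewrite mul1r.
  by congr (_ *: (_ *: e _) = _); apply: val_inj.
Qed.

(** a - b kills all of V, which has dimension k > l. *)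
Lemma code_inj a b M : P a -> P b -> mul_matrix a M -> mul_matrix b M -> a = b.
Proof.
move=> Pa Pb Ma Mb; apply/eqP; rewrite -subr_eq0; apply: contraT => ab0.
have abV (v : V) : (a - b) *: v = 0.
  have [c ->] := (be.1 v).1 I; rewrite scale_lincomb; apply: big1 => j _.
  by rewrite scalerBl Ma Mb subrr [LHS](act0r actP).
have : has_dim act [set v : V | (a - b) *: v = 0]%classic k.
  exists e; split; last exact: be.2.
  by move=> v; split=> [_|_]; [apply: (be.1 v).1 | apply: abV].
by move/(code_kernel_lt (PB Pa Pb) ab0); rewrite ltnNge ltnW.
Qed.

(** By rank-nullity the rank of L_a is k minus the dimension of its kernel. This
    dimension is less than l for all nonzero a in P, and it is l - 1 for the a of
    [code_low_rank], whose kernel contains l - 1 vectors of the basis. *)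
Lemma code_min_dist : is_min_dist (skew_code P e) (k - l + 1).
Proof.
split; last first.
  move=> X Y r [a Pa Ma] [b Pb Mb] XY /(has_rank_dist_range r Ma Mb).
  apply: code_rank_geq; first exact: PB.
  by rewrite subr_eq0; apply/eqP => ab; apply: XY; rewrite ab in Ma;
    apply: mul_matrix_unique Ma Mb.
have [a [Pa a0 ae]] := code_low_rank.
have [M Ma] := mul_matrix_exists a; have [M0 Ma0] := mul_matrix_exists 0.
exists M, M0; split.
- by exists a.
- by exists 0.
- move=> E; rewrite -E in Ma0; case/eqP: a0.
  exact: code_inj Pa P0 Ma Ma0.
apply/(has_rank_dist_range _ Ma Ma0); rewrite subr0.
have [j dj] := kernel_has_dim a; have [r dr] := range_has_dim a.
have kjr := rank_kernel dj dr; have lt_jl := code_kernel_lt Pa a0 dj.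
have le : (l.-1 <= k)%N by apply: leq_trans (leq_pred l) (ltnW l_lt_k).
suff le_lj : (l.-1 <= j)%N.
  have -> : (k - l + 1 = r)%N by move: kjr lt_jl le_lj l_gt0 l_lt_k; clear; lia.
  by [].
apply: (@has_dim_bound B^c V act actP divB _ _ _ (fun i => e (widen_ord le i)) dj).
  by move=> i; apply: ae; exact: (ltn_ord i).
move=> c Ec i.
pose c' (i : 'I_k) := if insub (val i) is Some i' then c i' else 0.
have c'E i' : c' (widen_ord le i') = c i'.
  rewrite /c' (insubT (fun x => x < l.-1)%N (ltn_ord i')).
  by congr c; apply: val_inj.
rewrite -c'E; apply: be.2; rewrite -[RHS]Ec /lincomb.
rewrite (bigID (fun i : 'I_k => (i < l.-1)%N)) /= [X in _ + X]big1 ?addr0.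
  rewrite (big_ord_narrow le); apply: eq_bigr => i' _; congr (act _ _).
  exact: c'E.
move=> i' /negPf lt; rewrite /c' insubF //; exact: (act0l actP).
Qed.

End Code.

(** * Dimensions over F' *)

Lemma field_division_ring (K : fieldType) : division_ring K.
Proof. by move=> a a0; exists a^-1; rewrite mulVf. Qed.

Lemma has_dim_vect (K : fieldType) (vT : vectType K) :
  has_dim (fun (c : K) (x : vT) => c *: x) setT (\dim {:vT}).
Proof.
exists (fun i => (vbasis {:vT})`_i); split=> [v|c E i].
  split=> // _; exists (fun i => coord (vbasis {:vT}) i v).
  by rewrite {1}(coord_vbasis (memvf v)).
by have /freeP := basis_free (vbasisP {:vT}); apply.
Qed.

Section CenterDegree.
Variables (C : fieldType) (D : falgType C).
Hypothesis D_center : 'Z({:D})%VS = 1%VS.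
Variables (sigma : {rmorphism D -> D}) (sigma_bij : bijective sigma).
Variables (n : nat) (u : D).
Hypotheses (n_gt0 : (0 < n)%N) (u_unit : u \is a GRing.unit).
Hypothesis sigma_n : forall z, iter n sigma z = u * z * u^-1.
Local Notation F := (fixF sigma).

(** sigma is onto, so that it maps central elements to central elements. *)
Lemma sigma_center (c : C) : exists c' : C, sigma c%:A = c'%:A.
Proof.
suff : sigma c%:A \in 'Z({:D})%VS by rewrite D_center => /vlineP[c' ->]; exists c'.
rewrite memv_cap memvf; apply/centvP => x _; have [tau _ tauK] := sigma_bij.
by rewrite -(tauK x) -!rmorphM -scalerAl -scalerAr mul1r mulr1.
Qed.

(** Artin's bound [C : F] <= n. Among the vectors x orthogonal to all the
    conjugates of the c_j, one of minimal support with a coordinate 1 is fixed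
    by sigma, because sigma x - x is again orthogonal and has smaller support;
    x is then a linear relation over F. *)
Lemma center_degree_leq : exists2 s, (s <= n)%N
  & has_dim (fun (a : F) (c : C) => val a * c) setT s.
Proof.
apply: bounded_has_dim => //.
- by split=> [v|a b v|v a b|a v w]; rewrite ?mul1r ?mulrA ?mulrDr // mulrDl.
- exact: field_division_ring.
have /choice[tau tauE] := sigma_center.
have inj_alg (a b : C) : a%:A = b%:A :> D -> a = b by move/(fmorph_inj (in_alg D)).
have tauD : {morph tau : x y / x - y}.
  by move=> x y; apply: inj_alg; rewrite -tauE scalerBl rmorphB /= !tauE -scalerBl.
have tauM : {morph tau : x y / x * y}.
  move=> x y; apply: inj_alg; rewrite -tauE -[LHS]/(sigma (in_alg D (x * y))).
  by rewrite !rmorphM /= !tauE -[RHS]/(in_alg D _) rmorphM.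
have tau1 : tau 1 = 1 by apply: inj_alg; rewrite -tauE scale1r rmorph1.
have tau0 : tau 0 = 0 by rewrite -{1}(subrr 0) tauD subrr.
have tau_sum I (r : seq I) (E : I -> C) :
    tau (\sum_(i <- r) E i) = \sum_(i <- r) tau (E i).
  apply: (big_morph tau) => // x y.
  by rewrite -{1}[y]opprK -[- y]sub0r !tauD tau0 sub0r opprK.
have tau_n c : iter n tau c = c.
  apply: inj_alg; have -> : (iter n tau c)%:A = iter n sigma c%:A :> D.
    by elim: (n) => //= i IH; rewrite -tauE IH.
  by rewrite sigma_n -scalerAr mulr1 -scalerAl divrr.
move=> s c _ indc; rewrite leqNgt; apply/negP => lt_ns.
pose ortho (x : 'I_s -> C) := forall i, \sum_j x j * iter i tau (c j) = 0.
pose supp (x : 'I_s -> C) := #|[pred j | x j != 0]|.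
(* sigma^n is inner, hence trivial on C: n conjugates are enough. *)
have ortho_n (x : 'I_s -> C) :
    (forall i : 'I_n, \sum_j x j * iter i tau (c j) = 0) -> ortho x.
  move=> xo i; have lt_in : (i %% n < n)%N by rewrite ltn_pmod.
  rewrite -[RHS](xo (Ordinal lt_in)); apply: eq_bigr => j _; congr (_ * _).
  rewrite {1}(divn_eq i n) addnC iterD; congr (iter _ tau _).
  by elim: (i %/ n)%N => // q IH; rewrite mulSn iterD IH tau_n.
pose Q k := `[< exists x, [/\ ortho x, supp x = k & exists j, x j = 1] >].
have exQ : exists k, Q k.
  have [x [[j xj0] xo]] := homogeneous_system (@field_division_ring C)
    (fun (j : 'I_s) (i : 'I_n) => iter i tau (c j)) lt_ns.
  exists (supp (fun i => (x j)^-1 * x i)); apply/asboolP; eexists; split=> //.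
    apply: ortho_n => i; under eq_bigr => i' _ do rewrite -mulrA.
    by rewrite -mulr_sumr xo mulr0.
  by exists j; rewrite mulVf.
have [k /asboolP[x [xo sx [j0 xj0]]] mink] := ex_minnP exQ.
have tx j : tau (x j) = x j.
  apply/eqP; rewrite -subr_eq0; apply: contraT => zj.
  pose z i := tau (x i) - x i; pose w i := (z j)^-1 * z i.
  have wo : ortho w.
    apply: ortho_n => i; under eq_bigr => i' _ do rewrite -mulrA.
    rewrite -mulr_sumr; under eq_bigr => i' _ do rewrite mulrBl.
    have E i' : iter i tau (c i') = tau (iter (i + n).-1 tau (c i')).
      by rewrite -iterS prednK ?iterD ?tau_n // addn_gt0 n_gt0 orbT.
    rewrite sumrB xo subr0.
    under eq_bigr => i' _ do rewrite E -tauM.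
    by rewrite -tau_sum xo tau0 mulr0.
  have /mink : Q (supp w).
    by apply/asboolP; exists w; split=> //; exists j; rewrite /w mulVf.
  rewrite -sx leqNgt => /negP[]; apply: proper_card; apply/fintype.properP; split.
    apply/fintype.subsetP => i; rewrite !inE /w /z; apply: contraNN => /eqP->.
    by rewrite tau0 subrr mulr0.
  exists j0; first by rewrite !inE xj0 oner_neq0.
  by rewrite !inE /w /z xj0 tau1 subrr mulr0 eqxx.
have xF i : x i \in fix_pred (in_alg D) sigma by rewrite inE /= tauE tx.
have /indc/(_ j0)/(congr1 val) :
    lincomb (fun (a : F) (c : C) => val a * c) (fun i => FixField (xF i)) c = 0.
  exact: (xo 0%N).
by rewrite /= xj0 => /eqP; rewrite oner_eq0.
Qed.

End CenterDegree.

Section Dimensions.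
Variables (C : fieldType) (D : falgType C).
Hypothesis D_division : forall x : D, x != 0 -> x \is a GRing.unit.
Variables (sigma rho : {rmorphism D -> D}).
Variables (f : monic_skewpoly sigma) (f_deg : (1 < skew_deg f)%N).
Hypothesis f_irr : nc_irreducible (f : skewpoly sigma).
Local Notation R := (skewpoly sigma).
Local Notation V := (lquot (f : R)).
Local Notation B := (nucr f).
Local Notation act := (@nucr_act D sigma f).
Local Notation F := (fixF sigma).
Local Notation F' := (fixF' sigma rho).
Local Notation divD := (unit_division_ring D_division).

Definition inD (c : F') : D := fixF_in sigma (val c).
Definition actD (c : F') (x : D) : D := inD c * x.
Definition actV (c : F') (v : V) : V := skewC sigma (inD c) *: v.

Lemma inD_comm c x : inD c * x = x * inD c.
Proof. exact: fixF_in_comm. Qed.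

Lemma actV_module : @module_action F' V actV.
Proof.
have inDM : {morph inD : a b / a * b} by move=> a b; rewrite /inD !rmorphM.
split=> [v|a b v|v a b|a v w]; rewrite /actV.
- by rewrite /inD !rmorph1 scale1r.
- by rewrite scalerA -rmorphM -inDM.
- by rewrite -scalerDl -rmorphD /inD !rmorphD.
- by rewrite scalerDr.
Qed.

(** The tower F' < F < C < D. *)
Lemma dim_D d s r : \dim {:D} = d ->
  has_dim (fun (a : F) (c : C) => val a * c) setT s ->
  has_dim (fun (c : F') (x : F) => val c * x) setT r ->
  has_dim actD setT (d * (s * r)).
Proof.
move=> dD ds dr.
have dC : has_dim (fun (c : F') (x : C) => val (val c) * x) setT (s * r).
  apply: has_dim_tower dr ds => [v a b|a v w|a x v] /=; rewrite ?mulrDr ?mulrDl //.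
  by rewrite mulrA.
apply: (@has_dim_tower _ C D _ _ (fun c x => c *: x)) dC _ => [v a b|a v w|a x v|].
- by rewrite scalerDl.
- by rewrite /actD mulrDr.
- by rewrite /actD /inD /= -scalerAl mul1r scalerA.
by rewrite -dD; apply: has_dim_vect.
Qed.

(** Remainders modulo f have the basis 1, t, ..., t^(m - 1), with m = deg f. *)
Lemma dim_V_over_D :
  has_dim (fun (a : D) (v : V) => skewC sigma a *: v) setT (skew_deg f).
Proof.
have sf : size f = (skew_deg f).+1.
  by rewrite /skew_deg prednK // (ltn_trans _ (monic_skew_size f)).
pose e (i : 'I_(skew_deg f)) : V := \pi_V (skewX sigma ^+ i).
have E c : lincomb (fun (a : D) (v : V) => skewC sigma a *: v) c e
    = \pi_V (\sum_i skewC sigma (c i) * skewX sigma ^+ i).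
  by rewrite raddf_sum; apply: eq_bigr => i _; rewrite /e scale_pi.
exists e; split=> [v|c].
  split=> // _; exists (fun i => (skew_rem f (repr v))`_i); rewrite E.
  rewrite -[LHS]reprK -[LHS]pi_rem; congr (\pi _); apply: skew_expand.
  by have := skew_rem_size f (repr v); rewrite sf.
rewrite E => /eqP; rewrite pi_eq0 -skew_rem_eq0.
pose p : R := SkewPoly sigma
  (\poly_(i < skew_deg f) (if insub i is Some j then c j else 0)).
have pc (i : 'I_(skew_deg f)) : p`_i = c i.
  rewrite coef_poly ltn_ord (insubT (fun x => x < skew_deg f)%N (ltn_ord i)).
  by congr c; apply: val_inj.
have -> : \sum_i skewC sigma (c i) * skewX sigma ^+ i = p.
  rewrite [RHS](@skew_expand _ _ _ (skew_deg f)); last exact: size_poly.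
  by apply: eq_bigr => i _; rewrite pc.
rewrite skew_rem_id; last by rewrite sf ltnS; apply: size_poly.
by move=> /eqP p0 i; rewrite -pc p0 coef0.
Qed.

Lemma dim_V q : has_dim actD setT q -> has_dim actV setT (skew_deg f * q).
Proof.
move=> dD; apply: has_dim_tower dD dim_V_over_D => [v a b|a v w|a x v].
- by rewrite rmorphD scalerDl.
- by rewrite /actV scalerDr.
- by rewrite /actV scalerA -rmorphM.
Qed.

Definition actB (c : F') (x : B) : B := nucr_const f (val c) * x.

(** Elements of F' are central in R, so it does not matter on which side they act. *)
Lemma nucr_act_const c (x : B) v : act (actB c x) v = actV c (act x v).
Proof.
have [_ actA _ _] := nucr_module_action f_deg.
rewrite -[v]reprK /actV nucr_actE // [act x _]nucr_actE // scale_pi.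
rewrite /actB /= /petit_mul; have cC := fixF_central (val c).
rewrite -/(inD c) in cC *.
rewrite [RHS](_ : _ = \pi_V (repr v * (skewC sigma (inD c) * val x))).
  by rewrite -!(scale_pi _ (repr v)) pi_rem.
by rewrite !mulrA cC.
Qed.

(** B embeds in V by its action on the class of 1. *)
Lemma dim_B q : has_dim actD setT q -> exists b, has_dim actB setT b.
Proof.
move=> dD; pose phi (x : B) : V := act x (\pi 1).
have [act1 actA actDl actDr] := nucr_module_action f_deg.
have phiB : zmod_morphism phi.
  by move=> x y; rewrite [LHS]actDl [act (- y) _](actNl (nucr_module_action f_deg)).
have phi_inj : injective phi.
  move=> x y /eqP; rewrite -subr_eq0 -phiB => /eqP E; apply/eqP; rewrite -subr_eq0.
  apply: contraT => xy; have := nucr_act_inj divD f_deg f_irr xy E.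
  by move/eqP; rewrite (negPf (pi1_neq0 f_irr)).
have [|b db] := @subspace_has_dim _ _ _ actV_module (@field_division_ring _)
   (phi @` setT)%classic setT _ (fun _ _ => I) _ (dim_V dD).
  split; first by exists 0 => //; rewrite /phi [LHS](act0l (nucr_module_action f_deg)).
  move=> c _ _ [x _ <-] [y _ <-]; exists (actB c x + y) => //.
  by rewrite /phi [LHS]actDl nucr_act_const.
have bij_id : bijective (@id F') by exists id.
exists b; move: db; apply: (@has_dim_image F' F' _ _ actB actV id phi _ b actV_module
  bij_id erefl phiB phi_inj _).1 => c x.
exact: nucr_act_const.
Qed.

(** Both sides are the dimension of V over F'. *)
Lemma dim_B_V k (e : 'I_k -> V) q b : right_basis e -> has_dim actD setT q ->
  has_dim actB setT b -> (k * b = skew_deg f * q)%N.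
Proof.
move=> be dD dB; have [_ _ actDl actDr] := nucr_module_action f_deg.
apply: has_dim_unique actV_module (@field_division_ring _) _ _ _ _ (dim_V dD).
apply: (@has_dim_tower F' B^c V actB actV act setT b k) dB _ => [//|c v w|//|].
- by rewrite /actV scalerDr.
- exact: nucr_act_const.
- by exists e.
Qed.

Lemma dim_ffun N q : has_dim actD setT q ->
  has_dim (fun (c : F') (v : {ffun 'I_N -> D}) => [ffun i => actD c (v i)])
    setT (N * q).
Proof.
move=> dD; apply: (@has_dim_tower F' D _ actD _
  (fun (x : D) (v : {ffun 'I_N -> D}) => [ffun i => x * v i])) dD _.
- by move=> v a b; apply/ffunP => i; rewrite !ffunE mulrDl.
- by move=> a v w; apply/ffunP => i; rewrite !ffunE /actD mulrDr.
- by move=> a x v; apply/ffunP => i; rewrite !ffunE /actD mulrA.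
have E c i : (lincomb (fun (x : D) (v : {ffun 'I_N -> D}) => [ffun i => x * v i]) c
    (fun j => [ffun i => (i == j)%:R])) i = c i.
  rewrite /lincomb sum_ffunE (bigD1 i) //= !ffunE eqxx mulr1 big1 ?addr0 // => j ji.
  by rewrite !ffunE eq_sym (negPf ji) mulr0.
exists (fun j => [ffun i => (i == j)%:R]); split=> [v|c E0 i].
  by split=> // _; exists v; apply/ffunP => i; rewrite E.
by rewrite -E E0 ffunE.
Qed.

End Dimensions.

(** * The code of the polynomials P *)

Section MRDPolys.
Variables (C : fieldType) (D : falgType C) (sigma : {rmorphism D -> D}).
Variables (nu : D) (rho : {rmorphism D -> D}) (N : nat) (N_gt0 : (0 < N)%N).
Local Notation R := (skewpoly sigma).
Local Notation F' := (fixF' sigma rho).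
Implicit Type d : nat -> D.

Definition mrd_poly d : R := \sum_(i < N) skewC sigma (d i) * skewX sigma ^+ i
  + skewC sigma (nu * rho (d 0%N)) * skewX sigma ^+ N.

Lemma mrd_poly_coef d i : (mrd_poly d)`_i =
  if (i < N)%N then d i else nu * rho (d 0%N) *+ (i == N).
Proof.
have E c j : (skewC sigma c * skewX sigma ^+ j)`_i = c *+ (i == j).
  by rewrite skew_coefCM skew_coefXn mulr_natr.
rewrite skew_coefD E (raddf_sum (@skew_coefs D sigma)) coef_sum.
under eq_bigr => j _ do rewrite E.
case: ltnP => [lt_iN|le_Ni].
  rewrite (ltn_eqF lt_iN) addr0 (bigD1 (Ordinal lt_iN)) //= eqxx big1 ?addr0 // => j.
  by rewrite -val_eqE eq_sym => /negPf /= ->.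
by rewrite big1 ?add0r // => j _; rewrite gtn_eqF // (leq_trans (ltn_ord j)).
Qed.

Lemma mrd_poly_size d : (size (mrd_poly d) <= N.+1)%N.
Proof.
apply/leq_sizeP => i lt_Ni; rewrite mrd_poly_coef ltnNge (ltnW lt_Ni) /=.
by rewrite gtn_eqF.
Qed.

Lemma mrd_polyB d d' : mrd_poly (fun i => d i - d' i) = mrd_poly d - mrd_poly d'.
Proof.
apply: skewP => i; rewrite skew_coefB !mrd_poly_coef; case: ifP => // _.
by rewrite rmorphB mulrBr mulrnBl.
Qed.

(** P need not be a left D-module, because of rho; but rho fixes F'. *)
Lemma mrd_polyZ (c : F') d :
  mrd_poly (fun i => inD c * d i) = skewC sigma (inD c) * mrd_poly d.
Proof.
apply: skewP => i; rewrite skew_coefCM !mrd_poly_coef; case: ifP => // _.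
have rc : rho (inD c) = inD c by apply/eqP; apply: (valP c).
by rewrite rmorphM rc mulrnAr mulrA -inD_comm mulrA.
Qed.

Lemma mrd_poly_ext d d' :
  (forall i, (i < N)%N -> d i = d' i) -> mrd_poly d = mrd_poly d'.
Proof.
move=> E; apply: skewP => i; rewrite !mrd_poly_coef (E 0%N) //.
by case: ltnP => // /E.
Qed.

Lemma mrd_polys_low (a : R) : (size a <= N)%N -> a`_0 = 0 -> mrd_polys nu rho N a.
Proof.
move=> sa a0; exists (fun i => a`_i); apply: skewP => i.
rewrite mrd_poly_coef a0 rmorph0 mulr0 mul0rn; case: ltnP => // le_Ni.
by rewrite nth_default // (leq_trans sa).
Qed.

Definition ext0 (v : {ffun 'I_N -> D}) i : D := if insub i is Some j then v j else 0.

Lemma ext0E v (i : 'I_N) : ext0 v i = v i.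
Proof.
rewrite /ext0 (insubT (fun x => x < N)%N (ltn_ord i)); congr (v _).
exact: val_inj.
Qed.

Lemma mrd_polys_ffun (a : R) : mrd_polys nu rho N a -> exists v, a = mrd_poly (ext0 v).
Proof.
move=> [d ->]; exists [ffun i : 'I_N => d i]; apply: mrd_poly_ext => i lt_iN.
by rewrite (ext0E _ (Ordinal lt_iN)) ffunE.
Qed.

End MRDPolys.

Section MRDCode.
Variables (C : fieldType) (D : falgType C).
Hypothesis D_division : forall x : D, x != 0 -> x \is a GRing.unit.
Variables (sigma rho : {rmorphism D -> D}) (nu : D).
Variables (f : monic_skewpoly sigma) (f_deg : (1 < skew_deg f)%N).
Hypothesis f_irr : nc_irreducible (f : skewpoly sigma).
Local Notation R := (skewpoly sigma).
Local Notation V := (lquot (f : R)).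
Local Notation B := (nucr f).
Local Notation F' := (fixF' sigma rho).
Variables (k : nat) (e : 'I_k -> V) (be : right_basis e).
Variables (l : nat) (l_gt0 : (0 < l)%N) (l_lt_k : (l < k)%N).
Local Notation P := (@mrd_polys C D sigma nu rho (l * skew_deg f)).
Local Notation mp := (@mrd_poly C D sigma nu rho (l * skew_deg f)).
Hypothesis P_avoids : forall a : R, P a -> skew_deg a = (l * skew_deg f)%N ->
  ~ (forall p : R, irr_factor p a -> nc_similar p (f : R)).
Variables (q b : nat).
Hypothesis dim_D : has_dim (@actD C D sigma rho) setT q.
Hypothesis dim_B : has_dim (@actB C D sigma rho f) setT b.

Let N_gt0 : (0 < l * skew_deg f)%N.
Proof. by rewrite muln_gt0 l_gt0 (ltn_trans _ f_deg). Qed.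

Let P0 : P 0.
Proof. by apply: mrd_polys_low; rewrite ?size_poly0 ?coef0. Qed.

Let PB a a' : P a -> P a' -> P (a - a').
Proof. by move=> [d ->] [d' ->]; eexists; rewrite -mrd_polyB. Qed.

Let P_size a : P a -> (size a <= (l * skew_deg f).+1)%N.
Proof. by move=> [d ->]; apply: mrd_poly_size. Qed.

Let P_low (a : R) : (size a <= l * skew_deg f)%N -> a`_0 = 0 -> P a.
Proof. exact: mrd_polys_low. Qed.

Lemma mrd_code_min_dist : is_min_dist (skew_code P e) (k - l + 1).
Proof. exact: code_min_dist. Qed.

Lemma mul_matrixZ (c : F') a M : mul_matrix e a M ->
  mul_matrix e (skewC sigma (inD c) * a) (nucr_const f (val c) *: M).
Proof.
move=> Ma j; rewrite -scalerA Ma scaler_sumr; apply: eq_bigr => i _.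
by rewrite mxE -[LHS](nucr_act_const f_deg).
Qed.

Local Notation iotaB := (nucr_const f \o val : {rmorphism F' -> B}).

(** The coefficients d_0, ..., d_(l m - 1), with m = deg f, parametrize the code.
    They are determined by the matrix because a nonzero a in P does not kill V. *)
Lemma mrd_code_dim : has_dim (@code_scale B k F' iotaB) (skew_code P e)
  (l * skew_deg f * q).
Proof.
have /choice[mm mmE] := mul_matrix_exists be.
pose phi (v : {ffun 'I_(l * skew_deg f) -> D}) := mm (mp (ext0 v)).
have P_ext (v : {ffun 'I_(l * skew_deg f) -> D}) : P (mp (ext0 v)) by eexists.
have -> : skew_code P e = (phi @` setT)%classic.
  apply/seteqP; split=> [M [a /(mrd_polys_ffun N_gt0)[v ->] Ma]|_ [v _ <-]].
    by exists v => //; apply: mul_matrix_unique (mmE _) Ma.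
  by exists (mp (ext0 v)); [apply: P_ext | apply: mmE].
have phiB : zmod_morphism phi.
  move=> v w; apply: mul_matrix_unique (mmE _) _ => //.
  rewrite (_ : mrd_poly _ _ _ _ _ = mp (fun i => ext0 v i - ext0 w i)).
    by rewrite mrd_polyB; apply: mul_matrixB.
  apply: mrd_poly_ext => // i lt_i.
  by rewrite !(ext0E _ (Ordinal lt_i)) !ffunE.
have bij_id : bijective (@id F') by exists id.
apply: (@has_dim_image F' F' _ _ _ _ id phi _ _ (code_scale_action k iotaB) bij_id erefl
  phiB _ _).2 (dim_ffun _ dim_D).
- move=> v w Evw; apply/ffunP => i.
  have : mp (ext0 v) = mp (ext0 w).
    apply: (code_inj D_division f_deg f_irr be l_lt_k PB P_size P_avoids
      (P_ext v) (P_ext w) (mmE _)).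
    by rewrite -/(phi v) Evw; apply: mmE.
  move=> /(congr1 (fun p : R => p`_i)); rewrite !mrd_poly_coef ltn_ord.
  by rewrite !ext0E.
- move=> c v; apply: mul_matrix_unique (mmE _) _ => //.
  rewrite (_ : mrd_poly _ _ _ _ _ = skewC sigma (inD c) * mp (ext0 v)).
    exact: mul_matrixZ.
  rewrite -mrd_polyZ; apply: mrd_poly_ext => // i lt_i.
  by rewrite !(ext0E _ (Ordinal lt_i)) !ffunE.
Qed.

(** The dimension l m q of the code is k l b, since k b = m q; and l is
    k - delta + 1 for the minimum distance delta = k - l + 1. *)
Lemma mrd_code_MRD : is_MRD iotaB (skew_code P e).
Proof.
split; first exact (has_dim_subspace (code_scale_action k iotaB) mrd_code_dim).
exists (l * skew_deg f * q)%N, b, (k - l + 1)%N; split.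
- exact: mrd_code_dim.
- exact: dim_B.
- exact: mrd_code_min_dist.
have := dim_B_V f_deg be dim_D dim_B.
have -> : (k - (k - l + 1) + 1 = l)%N by move: l_gt0 l_lt_k; clear; lia.
by rewrite -mulnA => <-; rewrite mulnCA mulnA.
Qed.

End MRDCode.

(** * Codes under an isomorphism of coefficient rings *)

Section CodeTransfer.
Variables (B E : nzRingType) (phi : {rmorphism B -> E}) (phi_bij : bijective phi).
Variables (k : nat) (code : set 'M[B]_k).

Definition map_code : set 'M[E]_k :=
  [set Y | exists2 X, code X & Y = map_mx phi X]%classic.

Let mapK m n : injective (fun X : 'M[B]_(m, n) => map_mx phi X).
Proof.
move=> X Y /matrixP XY; apply/matrixP => i j; apply: (bij_inj phi_bij).
by have := XY i j; rewrite !mxE.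
Qed.

Lemma col_rscale_module : @module_action E^c 'cV[E]_k (@col_rscale E k).
Proof.
split=> [v|a b v|v a b|a v w]; apply/colP => i; rewrite !mxE.
- by rewrite mulr1.
- by rewrite -mulrA.
- by rewrite -mulrDr.
- by rewrite mulrDl.
Qed.

Lemma map_colspace (X : 'M[B]_k) :
  (colspace (map_mx phi X) = map_mx phi @` colspace X)%classic.
Proof.
have [psi _ psiK] := phi_bij.
have map_comb c : map_mx phi (lincomb (@col_rscale B k) c (fun j => col j X))
    = lincomb (@col_rscale E k) (phi \o c) (fun j => col j (map_mx phi X)).
  rewrite /lincomb raddf_sum; apply: eq_bigr => j _.
  by apply/colP => i; rewrite !mxE; apply: rmorphM.
apply/seteqP; split=> [_ [c ->]|_ [_ [c ->] <-]]; last by eexists; apply: map_comb.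
exists (lincomb (@col_rscale B k) (psi \o c) (fun j => col j X)); first by eexists.
rewrite map_comb; congr (lincomb _ _ _); apply/funext => j; exact: psiK.
Qed.

Lemma map_rank_dist (X Y : 'M[B]_k) r :
  has_rank_dist (map_mx phi X) (map_mx phi Y) r <-> has_rank_dist X Y r.
Proof.
rewrite /has_rank_dist -map_mxB map_colspace.
apply: (@has_dim_image B^c E^c _ _ _ _ phi (map_mx phi) _ r col_rscale_module phi_bij
  (rmorph0 phi) _ (@mapK k 1)) => [v w|a v]; first exact: map_mxB.
by apply/colP => i; rewrite !mxE rmorphM.
Qed.

(** A ring isomorphism preserves column ranks. *)
Lemma map_code_min_dist delta : is_min_dist code delta -> is_min_dist map_code delta.
Proof.
move=> [[X [Y [cX cY XY dXY]]] mind]; split.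
  exists (map_mx phi X), (map_mx phi Y); split; first by exists X.
  - by exists Y.
  - by move/mapK.
  - exact/map_rank_dist.
move=> _ _ r [{cX dXY}X cX ->] [{cY}Y cY ->] {}XY /map_rank_dist.
by apply: mind => // e; apply: XY; rewrite e.
Qed.

Variables (K : fieldType) (iotaB : {rmorphism K -> B}) (iotaE : {rmorphism K -> E}).
Hypothesis phi_iota : forall c, phi (iotaB c) = iotaE c.

Lemma map_code_MRD : is_MRD iotaB code -> is_MRD iotaE map_code.
Proof.
have bij_id : bijective (@id K) by exists id.
have mod_code := @code_scale_action E k K iotaE.
have mod_E := mulr_module_action iotaE.
have map_codeE : map_code = (map_mx phi @` code)%classic.
  by apply/seteqP; split=> [_ [X cX ->]|_ [X cX <-]]; exists X.
move=> [_ [N [b [delta [dN db dmin EN]]]]].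
have dN' : has_dim (@code_scale E k K iotaE) map_code N.
  rewrite map_codeE.
  apply: (@has_dim_image K K _ _ (@code_scale B k K iotaB) _ id (map_mx phi)
    code N mod_code
    bij_id erefl _ (@mapK k k) _).2 => // [X Y|c X]; first exact: map_mxB.
  by apply/matrixP => i j; rewrite !mxE rmorphM phi_iota.
split; first exact (has_dim_subspace mod_code dN').
exists N, b, delta; split=> //; last exact: map_code_min_dist.
have -> : setT = (phi @` setT)%classic.
  have [psi _ psiK] := phi_bij.
  by apply/seteqP; split=> // y _; exists (psi y).
apply: (@has_dim_image K K _ _ (fun c x => iotaB c * x) _ id phi setT b mod_E
  bij_id erefl _
  (bij_inj phi_bij) _).2 => // [x y|c x]; first exact: rmorphB.
by rewrite rmorphM phi_iota.
Qed.

End CodeTransfer.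

(** * The nucleus and F[x] / (hhat) *)

Section CentralSubfield.
Variables (C : fieldType) (D : falgType C).
Hypothesis D_division : forall x : D, x != 0 -> x \is a GRing.unit.
Variables (sigma rho : {rmorphism D -> D}) (n : nat) (u : D).
Hypotheses (n_gt0 : (0 < n)%N) (u_unit : u \is a GRing.unit) (sigma_u : sigma u = u).
Hypothesis sigma_n : forall z, iter n sigma z = u * z * u^-1.
Variables (f : monic_skewpoly sigma) (f_deg : (1 < skew_deg f)%N).
Hypothesis f_irr : nc_irreducible (f : skewpoly sigma).
Local Notation R := (skewpoly sigma).
Local Notation F := (fixF sigma).
Local Notation F' := (fixF' sigma rho).
Local Notation B := (nucr f).
Local Notation ceval := (@central_eval C D sigma u n).
Variable hhat : {poly F}.
Hypothesis f_mclm : min_central_left_multiple u n f hhat.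
Hypothesis hhat_size : (1 < size hhat)%N.
Local Notation E := {poly %/ hhat}.

(** Elements of B are reduced modulo f, so they may be compared in R / Rf. *)
Lemma nucr_pi_inj (x y : B) :
  \pi_(lquot (f : R)) (val x) = \pi_(lquot (f : R)) (val y) -> x = y.
Proof.
move=> Exy; apply/eqP; rewrite -subr_eq0; apply: contraT => /nucr_pi_neq0.
by rewrite !raddfB subr_eq0 => /eqP[]; apply: Exy.
Qed.

(** A central polynomial c satisfies f c = c f, which is a left multiple of f. *)
Lemma central_nucr_proof (p : {poly F}) : skew_rem f (ceval p) \in right_nucleus f.
Proof.
rewrite right_nucleusE // skew_rem_size -skew_rem_eq0 skew_rem_mulr.
rewrite -(central_eval_central u_unit sigma_u sigma_n) skew_rem_eq0.
by apply/lidealP; exists (ceval p).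
Qed.

Definition central_nucr p : B := NucR (central_nucr_proof p).

Lemma central_nucrE p : \pi_(lquot (f : R)) (val (central_nucr p)) =
  \pi_(lquot (f : R)) (ceval p).
Proof. exact: pi_rem. Qed.

Lemma central_nucrB p q : central_nucr (p - q) = central_nucr p - central_nucr q.
Proof.
apply: nucr_pi_inj; rewrite central_nucrE central_evalB [LHS]raddfB.
rewrite [val (_ - _)]raddfB [RHS]raddfB.
by congr (_ - _); symmetry; apply: central_nucrE.
Qed.

Lemma central_nucrM p q : central_nucr (p * q) = central_nucr p * central_nucr q.
Proof.
apply: nucr_pi_inj; rewrite central_nucrE central_evalM [RHS]pi_rem.
have cC := central_eval_central u_unit sigma_u sigma_n.
rewrite -[RHS]scale_pi central_nucrE [RHS]scale_pi -[in RHS]cC -[RHS]scale_pi.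
by rewrite central_nucrE [RHS]scale_pi -[in RHS]cC.
Qed.

Lemma central_nucrC c : central_nucr c%:P = nucr_const f c.
Proof. by apply: nucr_pi_inj; rewrite central_nucrE central_evalC. Qed.

Lemma central_nucr_hhat : central_nucr hhat = 0.
Proof.
apply: nucr_pi_inj; rewrite central_nucrE !raddf0; apply/eqP; rewrite pi_eq0.
by case: f_mclm.
Qed.

Lemma mk_monic_hhat : mk_monic hhat = hhat.
Proof. by case: f_mclm => hm _ _ _; rewrite /mk_monic hhat_size hm. Qed.

(** h is a left multiple of f, so hhat becomes 0 in B. *)
Lemma central_nucr_mod p : central_nucr (val (in_qpoly hhat p)) = central_nucr p.
Proof.
have hm : hhat \is monic by case: f_mclm.
have Ep : val (in_qpoly hhat p) = p - Pdiv.Ring.rdivp p hhat * hhat.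
  by rewrite /= mk_monic_hhat {2}(Pdiv.RingMonic.rdivp_eq hm p) addrC addKr.
by rewrite Ep central_nucrB central_nucrM central_nucr_hhat mulr0 subr0.
Qed.

Definition central_qpoly (x : E) : B := central_nucr (val x).

Fact central_qpoly_zmod_morphism : zmod_morphism central_qpoly.
Proof. by move=> x y; rewrite /central_qpoly raddfB central_nucrB. Qed.

Fact central_qpoly_monoid_morphism : monoid_morphism central_qpoly.
Proof.
split=> [|x y]; rewrite /central_qpoly.
  2: by rewrite -central_nucrM -[RHS]central_nucr_mod.
by rewrite -[RHS](rmorph1 (nucr_const f)) -[RHS]central_nucrC.
Qed.

Lemma central_qpolyC c : central_qpoly (qpolyC hhat c) = nucr_const f c.
Proof. exact: central_nucrC. Qed.

(** A nonzero polynomial of degree less than deg hhat evaluates to a central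
    polynomial of degree less than deg h, which cannot be a multiple of f. *)
Lemma central_qpoly_inj : injective central_qpoly.
Proof.
move=> x y Exy; apply/eqP; rewrite -subr_eq0; apply: contraT => xy0.
have Ez : central_nucr (val (x - y)) = 0.
  by rewrite raddfB central_nucrB -/(central_qpoly x) Exy subrr.
have z0 : val (x - y) != 0 by apply: contraNneq xy0 => e; apply/eqP/val_inj.
have cz0 : ceval (val (x - y)) != 0.
  by rewrite -skew_size_eq0 (central_eval_size D_division).
have [hm _ _ minh] := f_mclm.
have := minh _ (central_eval_central u_unit sigma_u sigma_n _) (elimN eqP cz0).
rewrite -pi_eq0 -central_nucrE Ez !raddf0 eqxx => /(_ isT).
rewrite /skew_deg !(central_eval_size D_division) // ?monic_neq0 //= leq_pmul2l //.
have := size_mk_monic (x - y); rewrite [in X in (_ < X)%N]mk_monic_hhat.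
move: z0; rewrite -size_poly_gt0; move: (size hhat) (size _) => a b.
by clear; lia.
Qed.

Lemma dim_qpoly r : has_dim (fun (c : F') (x : F) => val c * x) setT r ->
  has_dim (fun (c : F') (x : E) => val c *: x) setT ((size hhat).-1 * r).
Proof.
move=> dr; apply: (@has_dim_tower F' F E _ _ (fun (c : F) (x : E) => c *: x)) dr _.
- by move=> v a b; rewrite scalerDl.
- by move=> a v w; rewrite scalerDr.
- by move=> a x v; rewrite scalerA.
have -> : (size hhat).-1 = \dim {:{poly_(size (mk_monic hhat)).-1 F}}.
  by rewrite dim_polyn mk_monic_hhat.
exact: has_dim_vect.
Qed.

(** E embeds in B over F', so that this inequality of dimensions is an equality. *)
Lemma central_qpoly_bij b r : has_dim (@actB C D sigma rho f) setT b ->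
  has_dim (fun (c : F') (x : F) => val c * x) setT r ->
  (b <= (size hhat).-1 * r)%N -> bijective central_qpoly.
Proof.
move=> dB /dim_qpoly dE le_b.
have bij_id : bijective (@id F') by exists id.
have modB : module_action (@actB C D sigma rho f).
  exact: mulr_module_action (nucr_const f \o val : {rmorphism F' -> B}).
have actE (c : F') (x : E) : central_qpoly (val c *: x) = actB c (central_qpoly x).
  rewrite /central_qpoly /actB -central_nucrC -central_nucrM; congr central_nucr.
  by rewrite mul_polyC.
have dI := (@has_dim_image F' F' E B (fun (c : F') (x : E) => val c *: x) _ id
  central_qpoly setT _ modB bij_id
  erefl central_qpoly_zmod_morphism central_qpoly_inj actE).2 dE.
have divF' := @field_division_ring F'.
have le : ((size hhat).-1 * r <= b)%N.
  exact: has_dim_sub_leq modB divF' _ _ _ _ _ dI dB.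
have {le le_b} Eb : b = ((size hhat).-1 * r)%N by apply/eqP; rewrite eqn_leq le_b.
rewrite Eb in dB; have onto := has_dim_sub_eq modB divF' (fun _ _ => I) dI dB.
have /choice[g gK] y : exists x, central_qpoly x = y.
  have [x _ <-] : (central_qpoly @` setT)%classic y by rewrite onto.
  by exists x.
by exists g => // x; apply: central_qpoly_inj; rewrite gK.
Qed.

Lemma nucr_qpoly_iso : bijective central_qpoly ->
  exists phi : {rmorphism B -> E}, bijective phi /\
    forall c : F, phi (nucr_const f c) = qpolyC hhat c.
Proof.
move=> [g qK gK].
have gB : zmod_morphism g.
  by move=> x y; apply: (can_inj qK); rewrite central_qpoly_zmod_morphism !gK.
have [q1 qM] := central_qpoly_monoid_morphism.
have gM : monoid_morphism g.
  by split=> [|x y]; apply: (can_inj qK); rewrite gK ?q1 // qM !gK.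
pose phi : {rmorphism B -> E} := HB.pack g
  (GRing.isZmodMorphism.Build B E g gB) (GRing.isMonoidMorphism.Build B E g gM).
exists phi; split; first by exists central_qpoly.
by move=> c; rewrite -central_qpolyC; apply: qK.
Qed.

End CentralSubfield.

(** * The MRD codes *)

Theorem theorem19
    (C : fieldType) (D : falgType C) (d : nat)
    (D_division : forall x : D, x != 0 -> x \is a GRing.unit)
    (D_center : 'Z({:D})%VS = 1%VS)
    (D_degree : \dim {:D} = (d ^ 2)%N)
    (sigma : {rmorphism D -> D}) (sigma_bij : bijective sigma)
    (n : nat) (u : D)
    (n_gt0 : (0 < n)%N)
    (u_unit : u \is a GRing.unit) (sigma_u : sigma u = u)
    (sigma_n : forall z, iter n sigma z = u * z * u^-1)
    (n_min : forall j : nat, (0 < j < n)%N -> ~ inner (iter j sigma))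
    (f : monic_skewpoly sigma) (m : nat)
    (f_deg : skew_deg f = m) (m_gt1 : (1 < m)%N)
    (f_irr : nc_irreducible (f : skewpoly sigma))
    (f_not_inv : ~ right_invariant (f : skewpoly sigma))
    (hhat : {poly fixF sigma})
    (f_mclm : min_central_left_multiple u n f hhat)
    (k : nat) (h_fact : has_irr_factorization (central_eval u n hhat) k)
    (nu : D) (rho : {rmorphism D -> D}) (rho_bij : bijective rho)
    (F_fin : exists r : nat,
       has_dim (fun (c : fixF' sigma rho) (x : fixF sigma) => val c * x) setT r)
    (l : nat) (l_gt0 : (1 <= l)%N) (l_lt_k : (l < k)%N)
    (P_avoids : forall a : skewpoly sigma,
       mrd_polys nu rho (l * m) a -> skew_deg a = (l * m)%N ->
       ~ (forall p : skewpoly sigma, irr_factor p a -> nc_similar p f)) :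
  let P : set (skewpoly sigma) := mrd_polys nu rho (l * m) in
  let B := nucr f in
  let E := {poly %/ hhat} in
  let iotaB : {rmorphism fixF' sigma rho -> B} := nucr_const f \o val in
  let iotaE : {rmorphism fixF' sigma rho -> E} := qpolyC hhat \o val in
  ((exists e : 'I_k -> lquot (f : skewpoly sigma), right_basis e) /\
   (forall e : 'I_k -> lquot (f : skewpoly sigma), right_basis e ->
      is_MRD iotaB (skew_code P e) /\
      is_min_dist (skew_code P e) (k - l + 1))) /\
  (skew_deg (central_eval u n hhat) = (d * m * n)%N ->
   k = (d * n)%N /\
   (exists phi : {rmorphism B -> E}, bijective phi /\
      forall c : fixF sigma, phi (nucr_const f c) = qpolyC hhat c) /\
   (forall (phi : {rmorphism B -> E}) (e : 'I_(d * n) -> lquot (f : skewpoly sigma)),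
      bijective phi ->
      (forall c : fixF sigma, phi (nucr_const f c) = qpolyC hhat c) ->
      right_basis e ->
      let codeE : set 'M[E]_(d * n) :=
        [set Y | exists2 X, skew_code P e X & Y = map_mx phi X]%classic in
      is_MRD iotaE codeE /\ is_min_dist codeE (d * n - l + 1))).
Proof.
move=> P B E iotaB iotaE.
rewrite -f_deg in m_gt1 P_avoids P *.
have divD := unit_division_ring D_division.
have [r dr] := F_fin.
have [s le_sn ds] := center_degree_leq D_center sigma_bij n_gt0 u_unit sigma_n.
have dD := dim_D D_degree ds dr.
have [b dB] := dim_B D_division m_gt1 f_irr dD.
have [N [e0 be0]] := lquot_has_basis D_division n_gt0 u_unit m_gt1 f_irr f_mclm.
have ENk : N = k := factorization_dim D_division sigma_bij n_gt0 u_unit sigma_u sigma_n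
  n_min m_gt1 f_irr f_mclm be0 h_fact.
rewrite {}ENk in e0 be0.
have [size_h _] := mclm_annihilator D_division sigma_bij n_gt0 u_unit sigma_u sigma_n
  n_min m_gt1 f_irr f_mclm be0.
have code_ok (e : 'I_k -> lquot (f : skewpoly sigma)) : right_basis e ->
    is_MRD iotaB (skew_code P e) /\ is_min_dist (skew_code P e) (k - l + 1).
  move=> be; split.
    exact: (mrd_code_MRD D_division m_gt1 f_irr be l_gt0 l_lt_k P_avoids dD dB).
  exact: (mrd_code_min_dist D_division m_gt1 f_irr be l_gt0 l_lt_k P_avoids).
split; first by split=> //; exists e0.
rewrite {1}/skew_deg size_h /= => deg_h.
have m_gt0 : (0 < skew_deg f)%N by apply: ltn_trans m_gt1.
have Ek : k = (d * n)%N.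
  by apply/eqP; rewrite -(eqn_pmul2r m_gt0) deg_h mulnAC.
have hhat0 : hhat != 0 by case: f_mclm => /monic_neq0.
have deg_hhat : (size hhat).-1 = (d * skew_deg f)%N.
  apply/eqP; rewrite -(eqn_pmul2l n_gt0) [X in _ == X]mulnC -deg_h.
  by move: size_h; rewrite (central_eval_size D_division) // => -[->].
have dn_gt0 : (0 < d * n)%N by rewrite -Ek; apply: leq_ltn_trans l_lt_k.
have d_gt0 : (0 < d)%N by move: dn_gt0; rewrite muln_gt0 => /andP[].
have hhat_size : (1 < size hhat)%N.
  have : (0 < (size hhat).-1)%N by rewrite deg_hhat muln_gt0 d_gt0.
  by case: (size hhat) => [|[]].
(* d n b = k b = m [D : F'] = m d^2 [C : F] [F : F'], and [C : F] <= n; thus b is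
   at most m d [F : F'], which is the dimension of E over F'. *)
have le_b : (b <= (size hhat).-1 * r)%N.
  rewrite -(leq_pmul2l dn_gt0) -{1}Ek (dim_B_V m_gt1 be0 dD dB) deg_hhat.
  have -> : (d * n * (d * skew_deg f * r) = skew_deg f * (d ^ 2 * (n * r)))%N.
    by rewrite expnS expn1; clear; lia.
  by rewrite !leq_mul2l leq_mul2r le_sn !orbT.
split=> //; split.
  have qbij := central_qpoly_bij D_division n_gt0 u_unit sigma_u sigma_n m_gt1 f_mclm
    hhat_size dB dr le_b.
  exact: nucr_qpoly_iso f_mclm hhat_size qbij.
rewrite Ek in code_ok => phi e phi_bij phi_const be; have [mrd md] := code_ok e be.
split; last exact: map_code_min_dist.
by apply: (map_code_MRD phi_bij _ mrd) => c; apply: phi_const.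
Qed.
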